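(* Let $f:(\mathbb{C}^n,0)\to(\mathbb{C},0)$ be a germ of a holomorphic function which is Newton non-degenerate with simplicial convenient Newton polytope. Then the combinatorial polynomials satisfy the symmetry $$r_\sigma(t)=r_\sigma(t^{-1})\,t^{\,n-d(\sigma)}$$ for every compact face $\sigma$ of $\Gamma_+(f)$ and also for $\sigma=\emptyset$.
   Context: Newton polytope. For $f=\sum_\nu c_\nu x^\nu\in\mathbb{C}\{x_1,\dots,x_n\}$ with $f(0)=0$, $\Gamma_+(f)\subset\mathbb{R}^n$ is the convex hull of the union of $\nu+\mathbb{R}_{\ge0}^n$ over all $\nu\in\mathbb{Z}_{\ge0}^n$ with $c_\nu\ne0$. It is convenient if it meets every coordinate axis of $\mathbb{R}^n$, and simplicial if each of its compact faces is a simplex. $f$ is (Newton) non-degenerate if for every compact face $\sigma$ of $\Gamma_+(f)$ one has $\bigcap_{i=1}^n\{x_i\partial_{x_i}f_\sigma=0\}\subset\{x_1\cdots x_n=0\}$ in $\mathbb{C}^n$, where $f_\sigma:=\sum_{\nu\in\sigma}c_\nu x^\nu$. $\Gamma_f$ denotes the union of the compact faces of $\Gamma_+(f)$; ''$\emptyset\le\sigma\le\Gamma_f$'' means that $\sigma$ is either a compact face of $\Gamma_+(f)$ or $\emptyset$, and $\sigma\le\tau$ means $\sigma$ is a face of $\tau$ (with $\emptyset\le\tau$ for all $\tau$). For a compact face $\sigma$, $d(\sigma):=\dim\sigma+1$ and $k(\sigma)$ is the integer such that $n-k(\sigma)$ is the number of coordinate hyperplanes of $\mathbb{R}^n$ containing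 $\sigma$; moreover $d(\emptyset)=k(\emptyset)=0$. The combinatorial polynomial is $$r_\sigma(t):=\sum_{\sigma\le\tau\le\Gamma_f}(-1)^{n-k(\tau)}(t-1)^{k(\tau)-d(\tau)},$$ where $\tau$ runs over the compact faces of $\Gamma_+(f)$ having $\sigma$ as a face (including $\tau=\sigma$, and in particular including $\tau=\emptyset$ if $\sigma=\emptyset$). *)

(* Defs.v *)
From mathcomp Require Import all_boot all_order all_algebra.
From mathcomp Require Import all_classical all_reals.
From mathcomp Require Import ereal topology normedtype esum.
From mathcomp Require Import complex.
(* The notations of mpoly are incompatible with those of MathComp-Analysis. *)
From mathcomp Require Import -(notations) mpoly.

Set Implicit Arguments.
Unset Strict Implicit.
Unset Printing Implicit Defensive.
Import Order.TTheory GRing.Theory Num.Theory.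
Import numFieldNormedType.Exports.
Local Open Scope classical_set_scope.
Local Open Scope ring_scope.

Section ConvexGeometry.
Variables (R : realType) (n : nat).
Implicit Types (A P F s t : set 'rV[R]_n).

Definition convex_hull A : set 'rV[R]_n :=
  [set x | exists (m : nat) (p : 'I_m -> 'rV[R]_n) (w : 'I_m -> R),
     [/\ forall i, A (p i), forall i, 0 <= w i, \sum_i w i = 1
       & x = \sum_i w i *: p i]].

Definition affinely_independent (m : nat) (p : 'I_m -> 'rV[R]_n) : Prop :=
  forall w : 'I_m -> R,
    \sum_i w i = 0 -> \sum_i w i *: p i = 0 -> forall i, w i = 0.

Definition is_simplex A : Prop :=
  exists (m : nat) (p : 'I_m -> 'rV[R]_n),
    affinely_independent p /\ A = convex_hull (range p).

(* Nonempty faces of a polyhedron P: the loci in P where a linear form attains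
   its minimum over P. The zero form gives P itself. *)
Definition is_face P F : Prop :=
  F !=set0 /\
  exists l : 'rV[R]_n,
    F = [set x | P x /\
          forall y, P y -> \sum_i l 0 i * x 0 i <= \sum_i l 0 i * y 0 i].

Definition is_compact_face P F : Prop := is_face P F /\ compact F.

(* The relation "s <= t"; the empty set is below everything. *)
Definition face_le s t : Prop := s = set0 \/ is_face t s.

(* Dimension of the affine hull of a nonempty set: the largest m such that the
   set contains m + 1 affinely independent points. *)
Definition affine_dim s : nat :=
  \max_(m < n.+1 | `[< exists p : 'I_m.+1 -> 'rV[R]_n,
                         affinely_independent p /\ forall i, s (p i) >]) m.

Definition d s : nat := if s == set0 then 0%N else (affine_dim s).+1.

(* n minus the number of coordinate hyperplanes containing s. All n of them
   contain the empty set, so k set0 = 0. *)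
Definition k s : nat :=
  (n - #|[pred i : 'I_n | `[< forall x, s x -> x 0%R i = 0%R >]]|)%N.

End ConvexGeometry.

Section NewtonPolytope.
Variables (R : realType) (n : nat).

(* A power series in n variables over C = R[i] is given by its family of
   coefficients, indexed by the exponents nu : multinom n. It lies in
   C{x_1, ..., x_n}, i.e. defines a germ of a holomorphic function at the
   origin, iff it converges absolutely on some polydisc. *)
Definition power_series : Type := multinom n -> R[i].

Definition convergent (f : power_series) : Prop :=
  exists2 r : R, 0 < r &
    summable [set: multinom n]
      (fun nu => (ComplexField.Normc.normc (f nu) * r ^+ mdeg nu)%:E).

Definition exponent_vector (nu : multinom n) : 'rV[R]_n :=
  \row_i (nu i)%:R.

Definition newton_polytope (f : power_series) : set 'rV[R]_n :=
  convex_hull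
    (\bigcup_(nu in [set nu | f nu != 0])
       [set x | forall i, exponent_vector nu 0 i <= x 0 i]).

Definition convenient (f : power_series) : Prop :=
  forall i : 'I_n, exists2 x, newton_polytope f x &
    forall j, j != i -> x 0 j = 0.

Definition simplicial (f : power_series) : Prop :=
  forall s, is_compact_face (newton_polytope f) s -> is_simplex s.

(* The restriction f_s. A compact s contains finitely many exponents, so the
   sum is finite (a sum over an infinite support would be 0 by convention). *)
Definition face_part (f : power_series) (s : set 'rV[R]_n) : mpoly n R[i] :=
  \sum_(nu \in [set nu | s (exponent_vector nu)]) f nu *: mpolyX R[i] nu.

Definition non_degenerate (f : power_series) : Prop :=
  forall s, is_compact_face (newton_polytope f) s ->
  forall z : 'I_n -> R[i],
    (forall i : 'I_n,
       meval z (mpolyX R[i] (mnm1 i) * mderiv i (face_part f s)) = 0) ->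
    \prod_i z i = 0.

(* "emptyset <= s <= Gamma_f" *)
Definition le_Gamma (f : power_series) (s : set 'rV[R]_n) : Prop :=
  s = set0 \/ is_compact_face (newton_polytope f) s.

(* The Newton polytope has finitely many faces, so the sum is finite. Every s
   with le_Gamma f s satisfies d s <= k s <= n, so the subtractions on nat do
   not truncate. *)
Definition combinatorial_polynomial (f : power_series) (s : set 'rV[R]_n) :
    {poly int} :=
  \sum_(t \in [set t | le_Gamma f t /\ face_le s t])
    ((-1) ^+ (n - k t) * ('X - 1) ^+ (k t - d t) : {poly int}).

End NewtonPolytope.

(* Main.v *)
Require Import Defs.
From mathcomp Require Import all_boot all_order all_algebra.
From mathcomp Require Import all_classical all_reals.
From mathcomp Require Import ereal topology normedtype esum.
From mathcomp Require Import complex.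
From mathcomp Require Import -(notations) mpoly.
From mathcomp Require Import ring lra zify.

(** The compact faces of the Newton polytope are simplices, so each of them is
    identified with its set of vertices, and together with the empty set they
    form a simplicial complex. The polytope being convenient, every ray of the
    orthant leaves the origin through exactly one point of the union of the
    compact faces: the cones over these simplices triangulate the orthant. This
    is [face_cells_triangulation]; it is expressed by saying that every vector
    of the orthant is a combination of vertices with nonnegative weights
    supported on a cell, in exactly one way ([orthant_triangulation]).

    The heart of the proof is the Euler relation of such a triangulation. For a
    cell S contained in the coordinate subspace R^I, the sum of (-1)^|C| over
    the cells C of R^I containing S equals (-1)^|I| if S meets the relative
    interior of the orthant of R^I ([euler_interior]), and 0 if S lies on its
    boundary ([euler_boundary]): the link of S is a sphere in the first case, a
    ball in the second. To prove it, move the barycentre of every cell a little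
    in a fixed direction v and group the cells according to the cell in which
    the moved point lands. The cells that land in C form a Boolean interval
    with top C, so their alternating sum vanishes unless the interval is reduced
    to C; what remains are the cells entered backwards ([star_sum]). If S
    lies on the boundary and v points inside the orthant, there are none. If S
    is interior and v is outside the span of S, they are the cells containing
    one strictly larger interior cell, and an induction concludes.

    Given the Euler relation, the symmetry is a computation. With u = t - 1,
    the right-hand side is the sum over the cells C containing S of
       (-1)^(n - |C|) u^(k(C) - |C|) (1 + u)^((n - k(C)) + (|C| - |S|)),
    and the two powers of 1 + u count the sets I that contain the k(C)
    coordinates of C and the cells between S and C. Exchanging the sums leaves
    precisely the alternating sums that the Euler relation evaluates
    ([euler_expansion]).

    The triangulation itself comes from linear programming. For x in the
    orthant, minimize l.x over the linear forms l >= 0 that are at least 1 on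
    all exponents; convenience forces l > 0, so the exponents with l = 1 span a
    compact face, and by Farkas' lemma x lies in the cone over that face. Two
    cells having a common point in the interiors of their cones span the same
    face, because the form that supports one of them is then constant on the
    other ([face_cell_uniq]). *)

Set Implicit Arguments.
Unset Strict Implicit.
Unset Printing Implicit Defensive.
Import Order.TTheory GRing.Theory Num.Theory.
Import numFieldNormedType.Exports.
Local Open Scope ring_scope.

(** * Boolean intervals and linear combinations *)

Section BooleanIntervals.
Variables (A : comNzRingType) (T : finType).
Implicit Types (S C U : {set T}).

(** Expand the product over all t of the binomials x + y for t in U but not in
    S, 1 + 0 for t in S and 0 + 1 outside U: the zeros kill every C that does
    not lie between S and U. *)
Lemma sum_interval S U (x y : A) : S \subset U ->
  \sum_(C : {set T} | (S \subset C) && (C \subset U)) x ^+ #|C :\: S| * y ^+ #|U :\: C| =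
  (x + y) ^+ #|U :\: S|.
Proof.
move=> sSU.
pose F t : A := if t \in S then 1 else if t \in U then x else 0.
pose G t : A := if t \in S then 0 else if t \in U then y else 1.
have -> : (x + y) ^+ #|U :\: S| = \prod_t (F t + G t).
  rewrite (bigID (mem (U :\: S))) /= [X in _ = _ * X]big1 ?mulr1.
    rewrite -prodr_const; apply: eq_bigr => t.
    by rewrite inE /F /G => /andP[/negPf-> ->].
  move=> t; rewrite inE /F /G negb_and negbK.
  by case: ifP => //= tS; rewrite ?addr0 // => /negPf ->; rewrite add0r.
rewrite bigA_distr [RHS](bigID (fun C : {set T} => (S \subset C) && (C \subset U))) /=.
rewrite [X in _ = _ + X]big1 ?addr0.
  apply: eq_bigr => C /andP[sSC sCU].
  rewrite (bigID (mem C)) /=; congr (_ * _).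
    rewrite (bigID (mem S)) /= big1 ?mul1r; last first.
      by move=> t /andP[-> tS]; rewrite /F tS.
    rewrite -prodr_const; apply: eq_big => [t|t]; first by rewrite inE andbC.
    by rewrite inE /F => /andP[/negPf-> tC]; rewrite tC (fintype.subsetP sCU).
  rewrite (bigID (mem U)) /= [X in _ * X]big1 ?mulr1; last first.
    move=> t /andP[/negPf tC /negPf tU]; rewrite tC /G tU.
    by case: ifP => // /(fintype.subsetP sSU); rewrite tU.
  rewrite -prodr_const; apply: eq_big => [t|t]; first by rewrite inE.
  rewrite inE /G => /andP[/negPf tC tU]; rewrite tC tU.
  by case: ifP => // /(fintype.subsetP sSC); rewrite tC.
move=> C; rewrite negb_and => /orP[] /subsetPn[t t1 t2]; rewrite (bigD1 t) //=.
  by rewrite (negPf t2) /G t1 mul0r.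
rewrite t1 /F (negPf t2).
by case: ifP => [/(fintype.subsetP sSU)|]; rewrite ?(negPf t2) // mul0r.
Qed.

Lemma alternating_sum_interval S U : S \subset U ->
  \sum_(C : {set T} | (S \subset C) && (C \subset U)) (-1) ^+ #|C| =
  (if S == U then (-1) ^+ #|U| else 0) :> A.
Proof.
move=> sSU; transitivity ((-1) ^+ #|S| * ((-1 + 1) ^+ #|U :\: S|) : A).
  rewrite -(sum_interval _ _ sSU) mulr_sumr; apply: eq_bigr => C /andP[sSC sCU].
  by rewrite expr1n mulr1 -exprD cardsDS // subnKC // subset_leq_card.
rewrite addNr expr0n cards_eq0 finset.setD_eq0; case: eqP => [->|/eqP neq].
  by rewrite subxx mulr1.
rewrite [_ \subset _]negbTE ?mulr0 //.
by apply: contra neq => sUS; rewrite finset.eqEsubset sSU.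
Qed.

End BooleanIntervals.

Section LinearCombinations.
Variables (R : realType) (n : nat) (J : finType) (q : J -> 'rV[R]_n).
Implicit Types (c : J -> R).

Definition lincomb c : 'rV[R]_n := \sum_j c j *: q j.

(** Independence of the subfamily indexed by [S], phrased with coefficients on
    the whole index type so that no subtype of [S] appears. *)
Definition indep (S : {set J}) : Prop :=
  forall c, (forall j, j \notin S -> c j = 0) -> lincomb c = 0 ->
  forall j, c j = 0.

Lemma lincombD c1 c2 :
  lincomb (fun j => c1 j + c2 j) = lincomb c1 + lincomb c2.
Proof. by rewrite /lincomb -big_split; apply: eq_bigr => j _; rewrite scalerDl. Qed.

Lemma lincombZ a c : lincomb (fun j => a * c j) = a *: lincomb c.
Proof. by rewrite /lincomb scaler_sumr; apply: eq_bigr => j _; rewrite scalerA. Qed.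

Lemma lincombN c : lincomb (fun j => - c j) = - lincomb c.
Proof. by rewrite /lincomb -sumrN; apply: eq_bigr => j _; rewrite scaleNr. Qed.

Lemma lincombB c1 c2 :
  lincomb (fun j => c1 j - c2 j) = lincomb c1 - lincomb c2.
Proof. by rewrite lincombD lincombN. Qed.

Lemma lincomb_coord c i : lincomb c 0 i = \sum_j c j * q j 0 i.
Proof. by rewrite /lincomb summxE; apply: eq_bigr => j _; rewrite mxE. Qed.

Lemma lincomb_pred1 j : lincomb (fun k => (k == j)%:R) = q j.
Proof.
rewrite /lincomb (bigD1 j) //= eqxx scale1r big1 ?addr0 // => k /negPf ->.
by rewrite scale0r.
Qed.

Lemma lincomb_sum (I : finType) (w : I -> R) (C : I -> J -> R) :
  lincomb (fun j => \sum_i w i * C i j) = \sum_i w i *: lincomb (C i).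
Proof.
rewrite /lincomb (eq_bigr (fun j => \sum_i (w i * C i j) *: q j)); last first.
  by move=> j _; rewrite scaler_suml.
rewrite exchange_big; apply: eq_bigr => i _; rewrite scaler_sumr.
by apply: eq_bigr => j _; rewrite scalerA.
Qed.

Lemma indep_inj S c1 c2 : indep S ->
  (forall j, j \notin S -> c1 j = 0) -> (forall j, j \notin S -> c2 j = 0) ->
  lincomb c1 = lincomb c2 -> c1 = c2.
Proof.
move=> iS s1 s2 eq12; apply: funext => j; apply/eqP; rewrite -subr_eq0; apply/eqP.
apply: (iS (fun j => c1 j - c2 j)) => [k kS|]; first by rewrite s1 ?s2 ?subrr.
by rewrite lincombB eq12 subrr.
Qed.

Definition extend_coeffs (S : {set J}) (u : 'rV[R]_#|S|) : J -> R :=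
  fun t => \sum_a u 0 a * (t == enum_val a)%:R.

Lemma extend_coeffs_enum_val (S : {set J}) (u : 'rV[R]_#|S|) a :
  extend_coeffs u (enum_val a) = u 0 a.
Proof.
rewrite /extend_coeffs (bigD1 a) //= eqxx mulr1 big1 ?addr0 // => a' neq.
by rewrite (inj_eq enum_val_inj) eq_sym (negPf neq) mulr0.
Qed.

Lemma extend_coeffs_out (S : {set J}) (u : 'rV[R]_#|S|) t : t \notin S ->
  extend_coeffs u t = 0.
Proof.
move=> tS; rewrite /extend_coeffs big1 // => a _.
by case: eqP => [tE|]; rewrite ?mulr0 //; move: tS; rewrite tE enum_valP.
Qed.

Lemma lincomb_extend_coeffs (S : {set J}) (u : 'rV[R]_#|S|) :
  lincomb (extend_coeffs u) = \sum_a u 0 a *: q (enum_val a).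
Proof.
rewrite lincomb_sum; apply: eq_bigr => a _.
by rewrite lincomb_pred1.
Qed.

End LinearCombinations.

(** * Triangulations of the orthant and germs of segments *)

Section Triangulation.
Variables (R : realType) (n : nat) (T : finType) (b : T -> 'rV[R]_n).
Variable (K : {set {set T}}).
Implicit Types (S C : {set T}) (I : {set 'I_n}) (c : T -> R) (v x : 'rV[R]_n).

Definition nzsupp c : {set T} := [set t | c t != 0].

Definition indicator S : T -> R := fun t => (t \in S)%:R.

(** The cones over the cells triangulate the orthant, in terms of coordinates:
    c |-> sum of c t *: b t is a bijection from the nonnegative weights
    supported on a cell onto the orthant. [cell_cover] says that the cones
    cover, [cell_uniq] that their relative interiors are disjoint and that they
    are simplicial. *)
Record orthant_triangulation : Prop := OrthantTriangulation {
  generator_ge0 : forall t i, 0 <= b t 0 i;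
  cell_sub : forall S C, S \subset C -> C \in K -> S \in K;
  cell_cover : forall x, (forall i, 0 <= x 0 i) ->
    exists c, [/\ forall t, 0 <= c t, nzsupp c \in K & lincomb b c = x];
  cell_uniq : forall c1 c2, (forall t, 0 <= c1 t) -> (forall t, 0 <= c2 t) ->
    nzsupp c1 \in K -> nzsupp c2 \in K -> lincomb b c1 = lincomb b c2 -> c1 = c2
}.

Definition coord_support S : {set 'I_n} :=
  [set i | [exists t in S, b t 0 i != 0]].

Hypothesis tri : orthant_triangulation.

Lemma nzsuppP c S :
  (forall t, t \notin S -> c t = 0) <-> nzsupp c \subset S.
Proof.
split=> [cS|/fintype.subsetP sub t].
  apply/fintype.subsetP => t; rewrite inE; apply: contraNT => tS.
  by apply/eqP; exact: cS.
by apply: contraNeq => ct; apply: sub; rewrite inE.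
Qed.

(** Add the nonnegative weight |c| to the relation c: both |c| + c and |c| are
    nonnegative, supported on S, and represent the same vector. *)
Lemma cell_indep S : S \in K -> indep b S.
Proof.
move=> SK c cS c0 t.
pose p a := `|c a| + c a; pose m a := `|c a| : R.
suff : p = m by move/(congr1 (fun f => f t)); rewrite /p /m => ?; lra.
have pos a : 0 <= p a by rewrite /p -lerBlDr sub0r -normrN ler_norm.
apply: (cell_uniq tri) => //.
- by move=> a; rewrite /m.
- apply: (cell_sub tri _ SK); apply/nzsuppP => a aS.
  by rewrite /p cS // normr0 addr0.
- apply: (cell_sub tri _ SK); apply/nzsuppP => a aS.
  by rewrite /m cS // normr0.
- by rewrite /p lincombD c0 addr0.
Qed.

Lemma coord_supportP S i :
  reflect (exists2 t, t \in S & b t 0 i != 0) (i \in coord_support S).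
Proof. by rewrite inE; apply: exists_inP. Qed.

Lemma coord_supportPn S i :
  reflect (forall t, t \in S -> b t 0 i = 0) (i \notin coord_support S).
Proof.
rewrite inE negb_exists_in; apply: (iffP forall_inP) => H t tS.
  by apply/eqP; rewrite -[_ == _]negbK H.
by rewrite H // eqxx.
Qed.

Lemma coord_supportS S C : S \subset C ->
  coord_support S \subset coord_support C.
Proof.
move=> /fintype.subsetP sSC; apply/fintype.subsetP => i /coord_supportP[t tS bt].
by apply/coord_supportP; exists t => //; apply: sSC.
Qed.

Lemma indicator_ge0 S t : 0 <= indicator S t.
Proof. exact: ler0n. Qed.

Lemma nzsupp_indicator S : nzsupp (indicator S) = S.
Proof.
by apply/setP => t; rewrite inE /indicator pnatr_eq0 eqb0 negbK.
Qed.

Lemma lincomb_ge0 c i : (forall t, 0 <= c t) -> 0 <= lincomb b c 0 i.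
Proof.
move=> c0; rewrite lincomb_coord; apply: sumr_ge0 => t _.
by rewrite mulr_ge0 ?(generator_ge0 tri).
Qed.

Lemma barycenter_gt0 S i : i \in coord_support S ->
  0 < lincomb b (indicator S) 0 i.
Proof.
move=> /coord_supportP[t tS bt]; rewrite lincomb_coord (bigD1 t) //=.
rewrite ltr_pwDl //; first by rewrite /indicator tS mul1r lt0r bt (generator_ge0 tri).
by apply: sumr_ge0 => s _; rewrite mulr_ge0 ?indicator_ge0 ?(generator_ge0 tri).
Qed.

(** The points x + e *: v lie in the orthant for all small e >= 0, where x is
    the barycentre of the cell S (up to a factor). With m = 1 / e this becomes
    a condition on m *: x + v, for one m. *)
Definition germ_in_orthant S v : Prop := exists m : nat,
  forall i, 0 <= (m%:R *: lincomb b (indicator S) + v) 0 i.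

(** For small e > 0 the point x + e *: v, with x the barycentre of S, lies in the
    interior of the cone over the cell spanned by S and the support of [c]: the
    weight of this point is a large multiple of the indicator of S plus [c],
    after rescaling by 1 / e. *)
Definition germ_coords S v c : Prop :=
  [/\ lincomb b c = v, forall t, t \notin S -> 0 <= c t & S :|: nzsupp c \in K].

(** Adding a large multiple of the indicator of S makes both weights nonnegative,
    and uniqueness in the triangulation applies. *)
Lemma germ_coords_uniq S v c1 c2 :
  germ_coords S v c1 -> germ_coords S v c2 -> c1 = c2.
Proof.
move=> [v1 pos1 K1] [v2 pos2 K2].
pose M := \sum_t (`|c1 t| + `|c2 t|).
have M1 t : - c1 t <= M /\ - c2 t <= M.
  have : `|c1 t| + `|c2 t| <= M.
    rewrite /M (bigD1 t) //= lerDl; apply: sumr_ge0 => s _.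
    by rewrite addr_ge0.
  move: (ler_norm (- c1 t)) (ler_norm (- c2 t)); rewrite !normrN.
  by move: (normr_ge0 (c1 t)) (normr_ge0 (c2 t)) => *; split; lra.
have shift c : lincomb b (fun t => c t + M * indicator S t) =
    lincomb b c + M *: lincomb b (indicator S) by rewrite lincombD lincombZ.
have sub c : nzsupp (fun t => c t + M * indicator S t) \subset S :|: nzsupp c.
  apply/nzsuppP => t; rewrite !inE negb_or negbK /indicator.
  by move=> /andP[/negPf -> /eqP ->]; rewrite mulr0 addr0.
have : (fun t => c1 t + M * indicator S t) = (fun t => c2 t + M * indicator S t).
  apply: (cell_uniq tri).
  - move=> t; rewrite /indicator; case: (boolP (t \in S)) => tS.
      by rewrite mulr1; have [? ?] := M1 t; lra.
    by rewrite mulr0 addr0 pos1.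
  - move=> t; rewrite /indicator; case: (boolP (t \in S)) => tS.
      by rewrite mulr1; have [? ?] := M1 t; lra.
    by rewrite mulr0 addr0 pos2.
  - exact: (cell_sub tri (sub c1)).
  - exact: (cell_sub tri (sub c2)).
  - by rewrite !shift v1 v2.
move=> eq12; apply: funext => t.
by move/(congr1 (fun f => f t)): eq12 => /addIr.
Qed.

Lemma infinitely_often (U : finType) (g : nat -> U) :
  exists u, forall N, exists2 m, (N <= m)%N & g m = u.
Proof.
apply: contrapT => /forallNP none.
have /choice[N NP] u : exists N, forall m, (N <= m)%N -> g m <> u.
  have /existsNP[N NP] := none u; exists N => m Nm gm.
  by apply: NP; exists m.
by apply: (NP (g (\max_u N u)%N) (\max_u N u)%N) => //; apply: leq_bigmax.
Qed.

(** There are finitely many cells, so the points m *: x + v lie in the interior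
    of the same cone, over a cell C, for infinitely many integers m. On these m
    their weights are affine in m, with slope e representing x. The slope is
    nonnegative because the weights are, hence it is the weight of x, that is,
    the indicator of S; in particular S is contained in C. *)
Lemma germ_coords_exist S v : S \in K -> germ_in_orthant S v ->
  exists c, germ_coords S v c.
Proof.
move=> SK [m0 m0P]; set x := lincomb b (indicator S).
have x0 i : 0 <= x 0 i by apply: lincomb_ge0 => t; exact: indicator_ge0.
have /choice[c cP] m : exists c, [/\ forall t, 0 <= c t, nzsupp c \in K
    & lincomb b c = (m0 + m)%:R *: x + v].
  apply: (cell_cover tri) => i; rewrite natrD scalerDl addrAC mxE.
  by rewrite addr_ge0 ?m0P // mxE mulr_ge0.
(* One cell carries the points m *: x + v for infinitely many m. *)
have [C CP] := infinitely_often (fun m => nzsupp (c m)).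
have [m1 _ C1] := CP 0%N; have CK : C \in K by rewrite -C1; case: (cP m1).
have offC m t : nzsupp (c m) = C -> t \notin C -> c m t = 0.
  by move=> <-; rewrite inE negbK => /eqP.
have [m2 m12 C2] := CP m1.+1.
(* The slope of the weights as functions of m. *)
pose e t := (m2 - m1)%:R^-1 * (c m2 t - c m1 t).
have m21 : (m2 - m1)%:R != 0 :> R by rewrite pnatr_eq0 subn_eq0 -ltnNge.
have eC t : t \notin C -> e t = 0.
  by move=> tC; rewrite /e !offC // subrr mulr0.
have lc_diff m : (m1 <= m)%N -> lincomb b (c m) - lincomb b (c m1) = (m - m1)%:R *: x.
  move=> le1m; have [_ _ ->] := cP m; have [_ _ ->] := cP m1.
  by rewrite opprD addrACA subrr addr0 -scalerBl -natrB ?leq_add2l // subnDl.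
have ex : lincomb b e = x.
  by rewrite lincombZ lincombB lc_diff ?scalerA ?mulVf ?scale1r // ltnW.
have cE m : (m1 <= m)%N -> nzsupp (c m) = C ->
    c m = (fun t => c m1 t + (m - m1)%:R * e t).
  move=> le1m Cm; apply: (indep_inj (cell_indep CK)).
  - by move=> t tC; rewrite offC.
  - by move=> t tC; rewrite offC // eC // mulr0 addr0.
  - by rewrite lincombD lincombZ ex -lc_diff // addrC subrK.
have e_ge0 t : 0 <= e t.
  rewrite leNgt; apply/negP => et.
  have [m mP Cm] := CP (m1 + (Num.truncn (c m1 t / - e t)).+1)%N.
  have le1m : (m1 <= m)%N by apply: leq_trans mP; rewrite leq_addr.
  have [/(_ t) + _ _] := cP m; rewrite cE //; apply/negP; rewrite -ltNge.
  have ltm : c m1 t / - e t < (m - m1)%:R.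
    by apply: lt_le_trans (truncnS_gt _) _; rewrite ler_nat leq_subRL.
  by move: ltm; rewrite ltr_pdivrMr ?oppr_gt0 // mulrN; lra.
have eS : e = indicator S.
  apply: (cell_uniq tri) => //.
    by apply: (cell_sub tri _ CK); apply/nzsuppP => t /eC.
  by rewrite nzsupp_indicator.
have sSC : S \subset C by rewrite -(nzsupp_indicator S) -eS; apply/nzsuppP.
exists (fun t => c m1 t - (m0 + m1)%:R * indicator S t); split.
- rewrite lincombB lincombZ; have [_ _ ->] := cP m1.
  by rewrite addrC addrA addNr add0r.
- by move=> t /negPf tS; rewrite /indicator tS mulr0 subr0; case: (cP m1).
- apply: (cell_sub tri _ CK); rewrite finset.subUset sSC; apply/nzsuppP => t tC.
  rewrite offC // /indicator [t \in S]negbTE ?mulr0 ?subr0 //.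
  by apply: contra tC; apply: fintype.subsetP.
Qed.

End Triangulation.

(** * The Euler relation *)

Section EulerCharacteristic.
Variables (R : realType) (n : nat) (T : finType) (b : T -> 'rV[R]_n).
Variable (K : {set {set T}}).
Hypothesis tri : orthant_triangulation b K.
Implicit Types (S C : {set T}) (I : {set 'I_n}) (v : 'rV[R]_n).

Local Notation coord_support := (coord_support b).

(** C is the cell whose open cone receives the barycentre of S after a small
    move in the direction v. *)
Definition germ_carrier S v C : Prop :=
  exists2 c, germ_coords b K S v c & S :|: nzsupp c = C.

(** A point of the open cone over S that moves a little by - v stays in the cone
    over C. *)
Definition backward S v C : Prop :=
  exists c, [/\ lincomb b c = v, nzsupp c \subset C
    & forall t, t \notin S -> c t <= 0].

(** Moving inside R^I does not leave R^I: a sum of nonnegative terms vanishes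
    only if all of them do. *)
Lemma coord_support_germ S v c I : germ_coords b K S v c ->
  (forall i, i \notin I -> v 0 i = 0) -> coord_support S \subset I ->
  coord_support (S :|: nzsupp c) \subset I.
Proof.
move=> [lcv pos _] vI SI; apply/fintype.subsetP => i; apply: contraLR => iI.
have /coord_supportPn bS : i \notin coord_support S.
  by apply: contra iI; apply: fintype.subsetP.
apply/coord_supportPn => t; case: (boolP (t \in S)) => [/bS //|tS].
rewrite !inE (negPf tS) /= => ct.
have terms_ge0 a : 0 <= c a * b a 0 i.
  case: (boolP (a \in S)) => [/bS -> |aS]; first by rewrite mulr0.
  by rewrite mulr_ge0 ?pos // (generator_ge0 tri).
have : \sum_a c a * b a 0 i = 0 by rewrite -lincomb_coord lcv vI.
move/eqP; rewrite psumr_eq0 // => /allP /(_ t); rewrite mem_index_enum.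
by move=> /(_ isT) /=; rewrite mulf_eq0 (negPf ct) => /eqP.
Qed.

(** Group the cells S containing S0 by the cell C that their barycentre enters
    when it moves along v. Let c be the coordinates of v in C. The cells that
    enter C are those between N and C, where N consists of S0 and of the vertices
    of C at which c is nonpositive; so their alternating sum vanishes unless
    N = C, which is the condition [backward]. *)
Lemma star_sum (A : comNzRingType) S0 v I :
  (forall i, i \notin I -> v 0 i = 0) ->
  (forall S, S \in K -> S0 \subset S -> coord_support S \subset I ->
     germ_in_orthant b S v) ->
  \sum_(S in K | (S0 \subset S) && (coord_support S \subset I))
     (-1) ^+ #|S| =
  \sum_(C in K | (S0 \subset C) && (coord_support C \subset I))
     (if `[< backward S0 v C >] then (-1) ^+ #|C| else 0) :> A.
Proof.
move=> vI inO.
transitivity (\sum_(S in K | (S0 \subset S) && (coord_support S \subset I))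
   \sum_(C | `[< germ_carrier S v C >]) (-1) ^+ #|S| : A).
  apply: eq_bigr => S /andP[SK /andP[sS0 SI]].
  have [c cP] := germ_coords_exist tri SK (inO S SK sS0 SI).
  rewrite (big_pred1 (S :|: nzsupp c)) // => C; apply/asboolP/eqP => [[c' c'P <-]|->].
    by rewrite (germ_coords_uniq tri c'P cP).
  by exists c.
rewrite (exchange_big_dep
  (fun C => (C \in K) && ((S0 \subset C) && (coord_support C \subset I)))) /=.
  apply: eq_bigr => C /andP[CK /andP[sC CI]].
  case: (pselect (exists c, lincomb b c = v /\ nzsupp c \subset C)); last first.
    move=> none; rewrite big_pred0; first case: asboolP => // - [c [? ? _]].
      by case: none; exists c.
    move=> S; apply/negP => /andP[_ /asboolP[c [lcv _ _] eqC]].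
    by case: none; exists c; split => //; rewrite -eqC finset.subsetUr.
  case=> c [lcv cC].
  have uniq_c c' : lincomb b c' = v -> nzsupp c' \subset C -> c' = c.
    move=> lcv' cC'.
    by apply: (indep_inj (cell_indep tri CK)) => [||]; rewrite ?nzsuppP ?lcv.
  (* A cell S is entered into C iff c is positive on the rest of C. *)
  pose N := S0 :|: [set t in C | c t <= 0].
  have NC : N \subset C.
    rewrite finset.subUset sC; apply/fintype.subsetP => t.
    by rewrite inE => /andP[].
  have -> : `[< backward S0 v C >] = (N == C).
    apply/asboolP/eqP => [[c' [lcv' cC' neg]]|eqNC].
      apply/eqP; rewrite finset.eqEsubset NC; apply/fintype.subsetP => t tC.
      rewrite !inE tC /= -(uniq_c c') //.
      by case: (boolP (t \in S0)) => //= /neg.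
    exists c; split => // t tS0.
    case: (boolP (t \in C)) => [|tC]; last by rewrite (proj2 (nzsuppP c C) cC).
    by rewrite -eqNC !inE (negPf tS0) => /andP[].
  rewrite -(alternating_sum_interval A NC); apply: eq_bigl => S.
  apply/andP/andP => [[/andP[SK /andP[sS SI]] /asboolP[c' c'P eqC]]|[sNS sSC]].
    have [lcv' pos _] := c'P.
    have eqc : c' = c by apply: uniq_c => //; rewrite -eqC finset.subsetUr.
    split; last by rewrite -eqC finset.subsetUl.
    rewrite finset.subUset sS; apply/fintype.subsetP => t.
    rewrite inE -eqC -eqc !inE; case: (boolP (t \in S)) => //= tS.
    by move=> /andP[ct /(conj (pos t tS))/andP]; rewrite -eq_le eq_sym (negPf ct).
  have cS : S :|: nzsupp c = C.
    apply/eqP; rewrite finset.eqEsubset finset.subUset sSC cC.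
    apply/fintype.subsetP => t tC; rewrite !inE.
    case: (boolP (t \in S)) => //= tS; apply: contra tS => /eqP ct.
    by apply: (fintype.subsetP sNS); rewrite !inE tC ct lexx orbT.
  split.
    rewrite (cell_sub tri sSC CK) (fintype.subset_trans _ sNS) ?finset.subsetUl //=.
    by rewrite (fintype.subset_trans _ CI) // coord_supportS.
  apply/asboolP; exists c => //; split => //; last by rewrite cS.
  move=> t tS; case: (boolP (t \in C)) => [tC|tC].
    rewrite leNgt; apply: contra tS => /ltW ct.
    by apply: (fintype.subsetP sNS); rewrite !inE tC ct orbT.
  by rewrite (proj2 (nzsuppP c C) cC).
move=> S C /andP[SK /andP[sS SI]] /asboolP[c cP <-].
rewrite (fintype.subset_trans sS (finset.subsetUl _ _)).
by rewrite (coord_support_germ cP) //; case: cP => _ _ ->.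
Qed.

(** The members of S, which lie in R^I in all applications, in the coordinates
    of R^I. *)
Definition generator_mx S I : 'M[R]_(#|S|, #|I|) :=
  \matrix_(a, j) b (enum_val a) 0 (enum_val j).

Lemma row_free_generator_mx S I : S \in K -> coord_support S \subset I ->
  row_free (generator_mx S I).
Proof.
move=> SK SI; apply: inj_row_free => u uM; apply/rowP => a; rewrite mxE.
rewrite -extend_coeffs_enum_val; apply: (cell_indep tri SK).
  by move=> t; exact: extend_coeffs_out.
rewrite lincomb_extend_coeffs; apply/rowP => i; rewrite summxE !mxE.
case: (boolP (i \in I)) => iI.
  move/rowP/(_ (enum_rank_in iI i)): uM; rewrite !mxE => uM.
  rewrite -[RHS]uM; apply: eq_bigr => a' _; rewrite !mxE enum_rankK_in //.
rewrite big1 // => a' _; rewrite mxE.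
have /coord_supportPn -> : i \notin coord_support S; rewrite ?mulr0 ?enum_valP //.
by apply: contra iI; apply: fintype.subsetP.
Qed.

Lemma card_cell S I : S \in K -> coord_support S \subset I -> (#|S| <= #|I|)%N.
Proof.
by move=> SK SI; rewrite -(eqP (row_free_generator_mx SK SI)) rank_leq_col.
Qed.

Lemma exists_coord_outside_span S I : S \in K -> coord_support S \subset I ->
  (#|S| < #|I|)%N ->
  exists2 j, j \in I & forall c, nzsupp c \subset S ->
    lincomb b c <> delta_mx 0 j.
Proof.
move=> SK SI ltSI.
have : ~~ row_full (generator_mx S I).
  by rewrite /row_full neq_ltn (leq_ltn_trans (rank_leq_row _) ltSI).
rewrite -sub1mx => /row_subPn[j jP]; exists (enum_val j); first exact: enum_valP.
move=> c cS lc; case/negP: jP; apply/submxP.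
exists (\row_a c (enum_val a)); apply/rowP => j'; rewrite !mxE.
move/rowP/(_ (enum_val j')): lc; rewrite lincomb_coord !mxE eqxx /=.
rewrite (inj_eq enum_val_inj) eq_sym => <-.
rewrite (bigID (mem S)) /= [X in _ + X]big1 ?addr0; last first.
  by move=> t tS; rewrite (proj2 (nzsuppP c S) cS) // mul0r.
by rewrite big_enum_val; apply: eq_bigr => a _; rewrite !mxE.
Qed.

(** Take v with all coordinates in I equal to 1: it points inside the orthant
    from every cell. If C were entered backwards from S, a coordinate j of I
    that vanishes on S would be nonpositive on v. *)
Lemma euler_boundary (A : comNzRingType) S I : coord_support S \proper I ->
  \sum_(C in K | (S \subset C) && (coord_support C \subset I))
     (-1) ^+ #|C| = 0 :> A.
Proof.
case/properP => SI [j jI /coord_supportPn jS].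
pose v : 'rV[R]_n := \row_i (i \in I)%:R.
rewrite (star_sum _ (v := v)).
- rewrite big1 // => C _; case: asboolP => // -[c [lcv cC neg]].
  move/rowP/(_ j): lcv; rewrite lincomb_coord !mxE jI => sum1.
  suff : \sum_t c t * b t 0 j <= 0 by rewrite sum1 ler10.
  apply: sumr_le0 => t _; case: (boolP (t \in S)) => [/jS -> | tS].
    by rewrite mulr0.
  by rewrite mulr_le0_ge0 ?neg // (generator_ge0 tri).
- by move=> i /negPf iI; rewrite mxE iI.
- by move=> C _ _ _; exists 0%N => i; rewrite scale0r add0r mxE ler0n.
Qed.

(** By induction on the codimension of S in R^I. If S does not span R^I, some
    basis vector v = e_j is outside its span. The cells entered backwards from S
    along v are those that contain the cell C entered from S along - v, which is
    strictly larger than S and still interior. *)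
Lemma euler_interior (A : comNzRingType) S I : S \in K -> coord_support S = I ->
  \sum_(C in K | (S \subset C) && (coord_support C \subset I))
     (-1) ^+ #|C| = (-1) ^+ #|I| :> A.
Proof.
move: {2}(#|I| - #|S|)%N (leqnn (#|I| - #|S|)) => m.
elim: m S => [|m IHm] S leSI SK SI.
  have cardS : #|S| = #|I|.
    by apply/eqP; rewrite eqn_leq card_cell ?SI //= -subn_eq0 -leqn0.
  rewrite (big_pred1 S) ?cardS // => C; apply/idP/eqP => [|->]; last first.
    by rewrite SK subxx SI subxx.
  move=> /andP[CK /andP[SC CI]]; apply/eqP; rewrite eq_sym eqEcard SC cardS.
  exact: card_cell.
have [leIS|ltSI] := leqP #|I| #|S|.
  by apply: IHm => //; rewrite (eqP leIS).
have subSI : coord_support S \subset I by rewrite SI.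
have [j jI jP] := exists_coord_outside_span SK subSI ltSI.
pose v : 'rV[R]_n := delta_mx 0 j.
have vI i : i \notin I -> v 0 i = 0.
  by rewrite mxE eqxx /=; case: eqP => // ->; rewrite jI.
have [c cP] : exists c, germ_coords b K S (- v) c.
  apply: (germ_coords_exist tri SK).
  have x_gt0 : 0 < lincomb b (indicator R S) 0 j.
    by apply: (barycenter_gt0 tri); rewrite SI.
  exists (Num.truncn (lincomb b (indicator R S) 0 j)^-1).+1 => i.
  rewrite !mxE eqxx /=; case: eqP => [->|_]; last first.
    rewrite oppr0 addr0 mulr_ge0 // (lincomb_ge0 tri) //.
  rewrite subr_ge0 -ler_pdivrMr // mul1r ltW //; exact: truncnS_gt.
have [lcv pos CK] := cP; set C := S :|: nzsupp c in CK.
have SC : S \subset C by exact: finset.subsetUl.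
have CI : coord_support C = I.
  apply/eqP; rewrite finset.eqEsubset (coord_support_germ cP) //; last first.
    by move=> i /vI vi; rewrite mxE vi oppr0.
  by rewrite -SI coord_supportS.
have ltSC : (#|S| < #|C|)%N.
  rewrite proper_card // finset.properEneq SC andbT; apply/eqP => eqSC.
  apply: (jP (fun t => - c t)); last by rewrite lincombN lcv opprK.
  apply/nzsuppP => t; rewrite eqSC !inE negb_or negbK => /andP[_ /eqP ->].
  by rewrite oppr0.
rewrite -[RHS](IHm C) //; last first.
  by rewrite -ltnS (leq_trans _ leSI) // ltn_sub2l.
rewrite (star_sum _ (v := v)) //; last first.
  move=> C' _ _ _; exists 0%N => i.
  by rewrite scale0r add0r mxE ler0n.
rewrite -big_mkcondr /=; apply: eq_bigl => C'; case: (boolP (C' \in K)) => //= C'K.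
rewrite -andbA andbCA [RHS]andbC; congr (_ && _).
apply/andP/idP => [[SC' /asboolP[c' [lcv' c'C' neg]]]|CC'].
  have c'P : germ_coords b K S (- v) (fun t => - c' t).
    split; first by rewrite lincombN lcv'.
      by move=> t /neg; rewrite oppr_ge0.
    apply: (cell_sub tri _ C'K); rewrite finset.subUset SC'; apply/nzsuppP => t tC'.
    by rewrite (proj2 (nzsuppP c' C') c'C') // oppr0.
  rewrite finset.subUset SC' (germ_coords_uniq tri cP c'P); apply/nzsuppP => t tC'.
  by rewrite (proj2 (nzsuppP c' C') c'C') // oppr0.
split; first exact: fintype.subset_trans CC'.
apply/asboolP; exists (fun t => - c t); split.
- by rewrite lincombN lcv opprK.
- apply: fintype.subset_trans CC'; apply/nzsuppP => t.
  by rewrite !inE negb_or negbK => /andP[_ /eqP ->]; rewrite oppr0.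
- by move=> t /pos; rewrite oppr_le0.
Qed.

End EulerCharacteristic.

(** * Symmetry of the polynomial of a triangulation *)

Section Symmetry.
Variables (R : realType) (n : nat) (T : finType) (b : T -> 'rV[R]_n).
Variable (K : {set {set T}}).
Hypothesis tri : orthant_triangulation b K.
Implicit Types (S C : {set T}) (I : {set 'I_n}).

Local Notation ncoord S := #|coord_support b S|.

Lemma card_cell_le_ncoord S : S \in K -> (#|S| <= ncoord S)%N.
Proof. by move=> SK; apply: (card_cell tri). Qed.

Lemma ncoord_le_n S : (ncoord S <= n)%N.
Proof. by rewrite -[X in (_ <= X)%N]card_ord max_card. Qed.

Lemma signr_subn (A : comNzRingType) (p q : nat) : (q <= p)%N ->
  (-1) ^+ (p - q) = (-1) ^+ p * (-1) ^+ q :> A.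
Proof.
by move=> qp; rewrite -[in RHS](subnK qp) exprD -mulrA -expr2 sqrr_sign mulr1.
Qed.

(** Expand (1 + u)^(n - k(S)) over the sets I of coordinates containing those of
    S, and (1 + u)^(|S| - |S0|) over the cells C between S0 and S. For fixed C
    and I, the sum over S is the one of the Euler relation for C in R^I; only I
    equal to the set of coordinates of C survives. *)
Lemma euler_expansion (A : comNzRingType) (u : A) S0 : S0 \in K ->
  \sum_(S in K | S0 \subset S)
     (-1) ^+ (n - #|S|) * u ^+ (ncoord S - #|S|) *
     (1 + u) ^+ (n - ncoord S + (#|S| - #|S0|)) =
  \sum_(S in K | S0 \subset S) (-1) ^+ (n - ncoord S) * u ^+ (ncoord S - #|S|).
Proof.
move=> S0K.
transitivity (\sum_(S in K | S0 \subset S)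
   \sum_(C : {set T} | (S0 \subset C) && (C \subset S))
   \sum_(I : {set 'I_n} | coord_support b S \subset I)
     (-1) ^+ n * u ^+ (#|I| - #|C|) * (-1) ^+ #|S|).
  apply: eq_bigr => S /andP[SK S0S].
  have leSk := card_cell_le_ncoord SK; have lekn := ncoord_le_n S.
  rewrite signr_subn ?(leq_trans leSk) // exprD.
  have -> : (1 + u) ^+ (n - ncoord S) =
      \sum_(I : {set 'I_n} | coord_support b S \subset I) u ^+ (#|I| - ncoord S).
    rewrite addrC -[X in (X - _)%N](card_ord n) -cardsT -cardsDS ?finset.subsetT //.
    rewrite -(sum_interval _ _ (finset.subsetT _)); apply: eq_big => [I|I sI].
      by rewrite finset.subsetT andbT.
    by rewrite expr1n mulr1 cardsDS //; case/andP: sI.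
  have -> : (1 + u) ^+ (#|S| - #|S0|) =
      \sum_(C : {set T} | (S0 \subset C) && (C \subset S)) u ^+ (#|S| - #|C|).
    rewrite -cardsDS // -(sum_interval _ _ S0S); apply: eq_bigr => C /andP[_ CS].
    by rewrite expr1n mul1r cardsDS.
  rewrite [X in _ * X = _]mulrC big_distrlr /= mulr_sumr.
  apply: eq_bigr => C /andP[_ /subset_leq_card CS].
  rewrite mulr_sumr; apply: eq_bigr => I /subset_leq_card SI.
  have -> : (#|I| - #|C| = (ncoord S - #|S|) + ((#|S| - #|C|) + (#|I| - ncoord S)))%N by lia.
  by rewrite !exprD; ring.
rewrite (exchange_big_dep (fun C => (C \in K) && (S0 \subset C))) /=; last first.
  by move=> S C /andP[SK _] /andP[-> CS]; rewrite (cell_sub tri CS).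
apply: eq_bigr => C /andP[CK S0C].
rewrite (exchange_big_dep (fun I => coord_support b C \subset I)) /=; last first.
  move=> S I /andP[_ /andP[_ CS]]; apply: fintype.subset_trans.
  exact: coord_supportS.
transitivity (\sum_(I : {set 'I_n} | coord_support b C \subset I)
  ((-1) ^+ n * u ^+ (#|I| - #|C|)) *
   \sum_(S in K | (C \subset S) && (coord_support b S \subset I))
      (-1) ^+ #|S|).
  apply: eq_bigr => I CI; rewrite mulr_sumr; apply: eq_bigl => S.
  rewrite S0C /=; case: (boolP (C \subset S)) => [CS|]; last by rewrite !andbF.
  by rewrite (fintype.subset_trans S0C CS) !andbT.
rewrite (bigD1 (coord_support b C)) //= (euler_interior tri) // big1 ?addr0.
  by rewrite signr_subn ?ncoord_le_n // mulrAC.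
move=> I /andP[CI neq]; rewrite (euler_boundary tri) ?mulr0 //.
by rewrite finset.properEneq eq_sym neq.
Qed.

Theorem triangulation_symmetry (F : fieldType) (t : F) S0 : S0 \in K -> t != 0 ->
  \sum_(S in K | S0 \subset S) (-1) ^+ (n - ncoord S) * (t - 1) ^+ (ncoord S - #|S|) =
  (\sum_(S in K | S0 \subset S)
     (-1) ^+ (n - ncoord S) * (t^-1 - 1) ^+ (ncoord S - #|S|)) * t ^+ (n - #|S0|).
Proof.
move=> S0K t0; rewrite -euler_expansion // mulr_suml.
apply: eq_bigr => S /andP[SK S0S].
have leSk := card_cell_le_ncoord SK; have lekn := ncoord_le_n S.
have leS0 := subset_leq_card S0S.
have -> : (n - #|S0| = (ncoord S - #|S|) + ((n - ncoord S) + (#|S| - #|S0|)))%N by lia.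
have -> : 1 + (t - 1) = t by ring.
have -> : t^-1 - 1 = - 1 * (t - 1) / t by field.
rewrite [in RHS]exprD !exprMn exprVn.
have -> : (n - #|S| = (n - ncoord S) + (ncoord S - #|S|))%N by lia.
rewrite [(-1) ^+ (_ + _)]exprD.
by rewrite -!mulrA [_^-1 * _]mulrA mulVf ?expf_neq0 // mul1r.
Qed.

End Symmetry.

(** * Farkas' lemma *)

Section Farkas.
Variables (R : realFieldType) (W : lmodType R).

Definition linear_form (h : W -> R) : Prop :=
  forall a x y, h (a *: x + y) = a * h x + h y.

(** Bartl's algebraic proof, by induction on the number of forms. If g is not
    already nonnegative where the other forms are, choose x0 there with
    g x0 < 0; then the first form is negative at x0. Projecting along x0 onto the
    kernel of the first form reduces to one form less. *)
Lemma farkas_ord m (a : 'I_m -> W -> R) (g : W -> R) :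
  (forall i, linear_form (a i)) -> linear_form g ->
  (forall x, (forall i, 0 <= a i x) -> 0 <= g x) ->
  exists2 c : 'I_m -> R, forall i, 0 <= c i &
    forall x, g x = \sum_i c i * a i x.
Proof.
elim: m a g => [|m IHm] a g a_lin g_lin gP.
  exists (fun=> 0) => // x; rewrite big_ord0.
  have g0 : g 0 = 0 by have := g_lin (-1) 0 0; rewrite scaler0 addr0; lra.
  have gN : g (- x) = - g x.
    by have := g_lin (-1) x 0; rewrite scaleN1r addr0 g0 addr0 mulN1r.
  apply/eqP; rewrite eq_le gP ?andbT; last by case.
  by rewrite -oppr_ge0 -gN gP //; case.
case: (pselect (forall x, (forall i, 0 <= a (lift ord0 i) x) -> 0 <= g x)).
  move=> gP'; have [c c0 cE] := IHm (fun i => a (lift ord0 i)) g (fun=> a_lin _) g_lin gP'.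
  exists (fun i => if unlift ord0 i is Some j then c j else 0).
    by move=> i; case: unliftP.
  move=> x; rewrite cE big_ord_recl unlift_none mul0r add0r.
  by apply: eq_bigr => i _; rewrite liftK.
move/existsNP=> [x0 /not_implyP[x0P /negP]]; rewrite -ltNge => gx0.
have ax0 : a ord0 x0 < 0.
  rewrite ltNge; apply/negP => ax0; move: gx0; rewrite ltNge gP // => i.
  by case: (unliftP ord0 i) => [j|] ->.
set r := - a ord0 x0; have r0 : 0 < r by rewrite oppr_gt0.
(* Both corrections vanish at x0, as r is minus the value of a ord0 at x0. *)
pose a' i x := a (lift ord0 i) x + a (lift ord0 i) x0 / r * a ord0 x.
pose g' x := g x + g x0 / r * a ord0 x.
have [|||c c0 cE] := IHm a' g'.
- by move=> i z x y; rewrite /a' !a_lin; ring.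
- by move=> z x y; rewrite /g' g_lin a_lin; ring.
- move=> x xP; set y := (a ord0 x / r) *: x0 + x.
  have -> : g' x = g y by rewrite /g' g_lin; ring.
  apply: gP => i; case: (unliftP ord0 i) => [j|] ->.
    suff -> : a (lift ord0 j) y = a' j x by exact: xP.
    by rewrite a_lin /a'; ring.
  suff -> : a ord0 y = 0 by [].
  rewrite a_lin /r; have ax0n : a ord0 x0 != 0 by rewrite lt_eqF.
  by field.
exists (fun i => if unlift ord0 i is Some j then c j
                 else (\sum_j c j * a (lift ord0 j) x0 - g x0) / r).
  move=> i; case: unliftP => // _; rewrite divr_ge0 // ?(ltW r0) // subr_ge0.
  by rewrite (le_trans (ltW gx0)) // sumr_ge0 // => j _; rewrite mulr_ge0.
move=> x; have -> : g x = g' x - g x0 / r * a ord0 x by rewrite /g' addrK.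
rewrite cE big_ord_recl unlift_none.
under [X in _ = _ + X]eq_bigr do rewrite liftK.
have -> : \sum_j c j * a' j x = \sum_j c j * a (lift ord0 j) x +
    (\sum_j c j * a (lift ord0 j) x0) / r * a ord0 x.
  by rewrite !mulr_suml -big_split; apply: eq_bigr => j _; rewrite /a' /=; ring.
by ring.
Qed.

Lemma farkas (J : finType) (a : J -> W -> R) (g : W -> R) :
  (forall j, linear_form (a j)) -> linear_form g ->
  (forall x, (forall j, 0 <= a j x) -> 0 <= g x) ->
  exists2 c : J -> R, forall j, 0 <= c j & forall x, g x = \sum_j c j * a j x.
Proof.
move=> a_lin g_lin gP.
have [i|//|x xP|c c0 cE] := @farkas_ord _ (fun i : 'I_#|J| => a (enum_val i)) g.
- exact: a_lin.
- by apply: gP => j; rewrite -(enum_rankK j); apply: xP.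
exists (fun j => c (enum_rank j)) => // x; rewrite cE.
rewrite (reindex (@enum_rank J)) /=; last first.
  by exists enum_val => i _; rewrite ?enum_valK ?enum_rankK.
by apply: eq_bigr => j _; rewrite enum_rankK.
Qed.

End Farkas.

(** A positive linear form, or a slack inequality, survives a small enough change;
    this is used to tilt supporting forms. *)
Lemma small_perturbation (R : realFieldType) (J : finType) (a d : J -> R) :
  exists2 e, 0 < e & forall j, 0 < a j -> 0 < a j + e * d j.
Proof.
pose s := \sum_(j | 0 < a j) `|d j| / a j.
have s0 : 0 <= s by apply: sumr_ge0 => j aj; rewrite divr_ge0 // ltW.
have s1 : 0 < 1 + s by rewrite ltr_pwDl.
exists (1 + s)^-1 => [|j aj]; first by rewrite invr_gt0.
have le_s : `|d j| / a j <= s.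
  rewrite /s (bigD1 j) //= lerDl; apply: sumr_ge0 => i /andP[ai _].
  by rewrite divr_ge0 // ltW.
have : `|d j| < a j * (1 + s).
  by rewrite mulrC -ltr_pdivrMr // (le_lt_trans le_s) // ltrDr.
rewrite -ltr_pdivrMr // => lt_a; move: (ler_norm (- d j)); rewrite normrN => le_d.
have : (1 + s)^-1 * - d j < a j.
  by rewrite mulrC (le_lt_trans _ lt_a) // ler_pM2r ?invr_gt0.
by rewrite mulrN; lra.
Qed.

(** * Convex hulls of finite families *)

Section Hulls.
Variables (R : realType) (n : nat).
Local Open Scope classical_set_scope.

Section Definitions.
Variables (J : finType) (q : J -> 'rV[R]_n) (S : {set J}).

Definition hull : set 'rV[R]_n :=
  [set x | exists w : J -> R, [/\ forall j, 0 <= w j,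
     forall j, j \notin S -> w j = 0, \sum_j w j = 1 & x = lincomb q w]].

Lemma hull_generator j : j \in S -> hull (q j).
Proof.
move=> jS; exists (fun i => (i == j)%:R); split.
- by move=> i; exact: ler0n.
- by move=> i; apply: contraNeq; rewrite pnatr_eq0 eqb0 negbK => /eqP ->.
- by rewrite (bigD1 j) //= eqxx big1 ?addr0 // => i /negPf ->.
- by rewrite lincomb_pred1.
Qed.

Lemma hull_nonempty : S != finset.set0 <-> hull !=set0.
Proof.
split=> [/set0Pn[j jS]|]; first by exists (q j); exact: hull_generator.
case=> x [w [_ wS sum1 _]]; apply/eqP => S0; move: sum1; rewrite big1.
  by move/eqP; rewrite eq_sym oner_eq0.
by move=> j _; rewrite wS // S0 finset.in_set0.
Qed.

(** It is the image of a compact set of weights under a continuous map. *)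
Lemma compact_hull : compact hull.
Proof.
pose f (w : 'rV[R]_#|J|) : 'rV[R]_n := \sum_a w ord0 a *: q (enum_val a).
pose box (a : 'I_#|J|) : set R := [set r | 0 <= r <= (enum_val a \in S)%:R].
pose B := [set w : 'rV[R]_#|J| | forall a, box a (w ord0 a)].
pose X := B `&` [set w | \sum_a w ord0 a = 1].
have sum_enum (V : nmodType) (F : J -> V) :
    \sum_j F j = \sum_a F (enum_val (a : 'I_#|J|)).
  by rewrite (reindex (@enum_val J J)) //; apply: onW_bij; exact: enum_val_bij.
have -> : hull = f @` X.
  rewrite eqEsubset; split=> [x [w [w0 wS sum1 ->]]|_ [u [uB /= sum1] <-]].
    have wle j : w j <= 1.
      by rewrite -sum1 (bigD1 j) //= lerDl; apply: sumr_ge0.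
    exists (\row_a w (enum_val a)); last first.
      by rewrite /f /lincomb sum_enum; apply: eq_bigr => a _; rewrite mxE.
    split=> [a|/=]; last by rewrite -sum1 sum_enum; apply: eq_bigr => a _; rewrite mxE.
    rewrite /box /= mxE w0; case: (boolP (enum_val a \in S)) => //= aS.
    by rewrite wS.
  exists (fun j => u ord0 (enum_rank j)); split.
  - by move=> j; have := uB (enum_rank j); rewrite /box /= => /andP[].
  - move=> j /negPf jS; have := uB (enum_rank j).
    rewrite /box /= enum_rankK jS /= => ?.
    by apply/eqP; rewrite eq_le andbC.
  - by rewrite sum_enum -sum1; apply: eq_bigr => a _; rewrite enum_valK.
  - by rewrite /lincomb sum_enum; apply: eq_bigr => a _; rewrite enum_valK.
have sum_cont (V : normedModType R) (g : 'I_#|J| -> V) :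
    continuous (fun w : 'rV[R]_#|J| => \sum_a w ord0 a *: g a).
  apply: continuous_big; first exact: add_continuous.
  move=> a _ w; apply: continuousZr_tmp; exact: coord_continuous.
apply: continuous_compact; first exact: continuous_subspaceT (sum_cont _ _).
apply: compact_closedI.
  by apply: rV_compact => a; rewrite /box -set_itvcc; exact: segment_compact.
have /continuous_closedP cont := sum_cont R^o (fun=> 1).
have sumE (w : 'rV[R]_#|J|) : \sum_a w ord0 a *: (1 : R^o) = \sum_a w ord0 a.
  by apply: eq_bigr => a _; exact: mulr1.
have := cont _ (@closed_eq R 1).
congr closed; apply/seteqP; split=> w /=; by rewrite sumE.
Qed.

End Definitions.

(** Substitute for each point of a nonnegative combination a convex combination
    of the new generators; the total weight does not change. *)
Lemma hull_transport (I J : finType) (p : I -> 'rV[R]_n) (q : J -> 'rV[R]_n)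
    (S : {set J}) (c : I -> R) :
  (forall i, 0 <= c i) -> (forall i, c i != 0 -> hull q S (p i)) ->
  exists c', [/\ forall j, 0 <= c' j, forall j, j \notin S -> c' j = 0,
    \sum_j c' j = \sum_i c i & lincomb q c' = lincomb p c].
Proof.
move=> c0 cP.
have /choice[w wP] i : exists w : J -> R, [/\ forall j, 0 <= w j,
    forall j, j \notin S -> w j = 0, c i * \sum_j w j = c i
    & c i *: lincomb q w = c i *: p i].
  have [ci0|/cP[w [w0 wS sum1 pE]]] := eqVneq (c i) 0.
    by exists (fun=> 0); rewrite ci0 mul0r !scale0r.
  by exists w; rewrite sum1 mulr1 -pE.
exists (fun j => \sum_i c i * w i j); split.
- by move=> j; apply: sumr_ge0 => i _; rewrite mulr_ge0 //; case: (wP i).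
- by move=> j jS; rewrite big1 // => i _; have [_ -> //] := wP i; rewrite mulr0.
- rewrite exchange_big; apply: eq_bigr => i _.
  by rewrite -mulr_sumr; case: (wP i).
- by rewrite lincomb_sum; apply: eq_bigr => i _; case: (wP i).
Qed.

Lemma hull_sub (I J : finType) (p : I -> 'rV[R]_n) (q : J -> 'rV[R]_n)
    (A : {set I}) (S : {set J}) :
  (forall i, i \in A -> hull q S (p i)) -> hull p A `<=` hull q S.
Proof.
move=> pS x [w [w0 wA sum1 ->]].
have [|c [c0 cS csum clc]] := hull_transport (p := p) (q := q) (S := S) w0.
  move=> i; apply: contraNP => /= npS; apply/eqP/wA/negP => iA.
  by apply: npS; exact: pS.
by exists c; rewrite csum clc.
Qed.

Lemma hull_subset (J : finType) (q : J -> 'rV[R]_n) (S C : {set J}) :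
  S \subset C -> hull q S `<=` hull q C.
Proof.
by move=> /fintype.subsetP sSC; apply: hull_sub => j /sSC; exact: hull_generator.
Qed.

(** A vertex of a simplex is extreme. Writing q i as a convex combination of
    points p j of the simplex, all the p j of nonzero weight have, by
    independence, zero coordinates away from i, and are thus equal to q i. *)
Lemma indep_generator_extreme (I J : finType) (q : I -> 'rV[R]_n)
    (p : J -> 'rV[R]_n) (A : {set I}) (S : {set J}) i :
  indep q A -> i \in A -> hull p S (q i) ->
  (forall j, j \in S -> hull q A (p j)) -> exists2 j, j \in S & p j = q i.
Proof.
move=> iA iinA [w [w0 wS sum1 qiE]] pA.
have /choice[y yP] j : exists y : I -> R, j \in S -> [/\ forall a, 0 <= y a,
    forall a, a \notin A -> y a = 0, \sum_a y a = 1 & p j = lincomb q y].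
  have [/pA[y yP]|jS] := boolP (j \in S); first by exists y.
  by exists (fun=> 0).
have inS j : w j != 0 -> j \in S by apply: contraNT => /wS ->.
have termE a j : 0 <= w j * y j a.
  have [->|/inS/yP[y0 _ _ _]] := eqVneq (w j) 0; first by rewrite mul0r.
  by rewrite mulr_ge0.
have deltaE : (fun a => \sum_j w j * y j a) = (fun a => (a == i)%:R).
  apply: (indep_inj iA).
  - move=> a aA; rewrite big1 // => j _.
    have [->|/inS/yP[_ -> // _ _]] := eqVneq (w j) 0; first by rewrite mul0r.
    by rewrite mulr0.
  - by move=> a; apply: contraNeq; rewrite pnatr_eq0 eqb0 negbK => /eqP ->.
  - rewrite lincomb_sum lincomb_pred1 qiE; apply: eq_bigr => j _.
    have [->|/inS/yP[_ _ _ -> //]] := eqVneq (w j) 0; by rewrite !scale0r.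
have [j wj] : exists j, w j != 0.
  apply/existsP; rewrite -negb_forall; apply/negP => /forallP w00.
  move: sum1; rewrite big1 => [/esym/eqP|j _]; first by rewrite oner_eq0.
  by apply/eqP; exact: w00.
exists j; first exact: inS.
have [_ _ ysum ->] := yP j (inS j wj).
have y_off a : a != i -> y j a = 0.
  move=> /negPf ai; have /(congr1 (fun h => h a)) := deltaE; rewrite /= ai.
  move/eqP; rewrite psumr_eq0 // => /allP/(_ j); rewrite mem_index_enum.
  by move=> /(_ isT) /=; rewrite mulf_eq0 (negPf wj) => /eqP.
rewrite -(lincomb_pred1 q i); congr lincomb; apply: funext => a.
have [->|/y_off //] := eqVneq a i.
by rewrite -ysum (bigD1 i) //= big1 ?addr0 // => a' /y_off.
Qed.

Lemma convex_hull_range m (p : 'I_m -> 'rV[R]_n) :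
  convex_hull (range p) = hull p [set: 'I_m]%SET.
Proof.
apply/seteqP; split=> x.
  move=> [l [r [w [rP w0 sum1 ->]]]].
  have -> : \sum_i w i *: r i = lincomb r w by [].
  apply: (@hull_sub _ _ r p [set: 'I_l]%SET) => [i _|].
    by have [a _ <-] := rP i; apply: hull_generator; rewrite finset.in_setT.
  by exists w; split => // i; rewrite finset.in_setT.
move=> [w [w0 _ sum1 ->]]; exists m, p, w; split => //.
Qed.

End Hulls.

(** * Compact faces and positive linear forms *)

Section NewtonPolyhedron.
Variables (R : realType) (n : nat) (T : finType) (b : T -> 'rV[R]_n).
Local Open Scope classical_set_scope.
Implicit Types (S C : {set T}) (l x : 'rV[R]_n).

Definition dot (l x : 'rV[R]_n) : R := \sum_i l 0 i * x 0 i.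

Lemma dot_lincomb (J : finType) (q : J -> 'rV[R]_n) (c : J -> R) l :
  dot l (lincomb q c) = \sum_j c j * dot l (q j).
Proof.
rewrite /dot; under eq_bigr do rewrite lincomb_coord mulr_sumr.
rewrite exchange_big; apply: eq_bigr => j _; rewrite mulr_sumr.
by apply: eq_bigr => i _; rewrite mulrCA.
Qed.

Lemma dotDl l m x : dot (l + m) x = dot l x + dot m x.
Proof.
by rewrite /dot -big_split; apply: eq_bigr => i _; rewrite mxE mulrDl.
Qed.

Lemma dotZl a l x : dot (a *: l) x = a * dot l x.
Proof. by rewrite /dot mulr_sumr; apply: eq_bigr => i _; rewrite mxE mulrA. Qed.

Lemma dot_delta i x : dot (delta_mx 0 i) x = x 0 i.
Proof.
rewrite /dot (bigD1 i) //= !mxE !eqxx mul1r big1 ?addr0 // => j /negPf ji.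
by rewrite mxE ji andbF mul0r.
Qed.

Lemma dot_mono l x (y : 'rV[R]_n) : (forall i, 0 <= l 0 i) -> (forall i, x 0 i <= y 0 i) ->
  dot l x <= dot l y.
Proof. by move=> l0 xy; apply: ler_sum => i _; rewrite ler_wpM2l. Qed.

Lemma linear_form_dot x : linear_form (fun l => dot l x).
Proof. by move=> a l m; rewrite dotDl dotZl. Qed.

(** The matrix of an independent family has a right inverse. *)
Lemma indep_dual S (g : T -> R) : indep b S ->
  exists l, forall t, t \in S -> dot l (b t) = g t.
Proof.
move=> iS; pose M : 'M[R]_(#|S|, n) := \matrix_(a, i) b (enum_val a) 0 i.
have : row_free M.
  apply: inj_row_free => u uM; apply/rowP => a; rewrite mxE.
  rewrite -extend_coeffs_enum_val; apply: iS => [t|].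
    exact: extend_coeffs_out.
  rewrite lincomb_extend_coeffs; apply/rowP => i.
  move/rowP/(_ i): uM; rewrite !mxE summxE => uM.
  by rewrite -[RHS]uM; apply: eq_bigr => a' _; rewrite !mxE.
move=> /row_freeP[B MB]; pose y := B *m (\col_a g (enum_val a)).
exists y^T => t tS.
have := congr1 (fun N => (N *m (\col_a g (enum_val a))) (enum_rank_in tS t) 0) MB.
rewrite /= -mulmxA mul1mx !mxE enum_rankK_in // => <-.
by apply: eq_bigr => i _; rewrite !mxE enum_rankK_in // mulrC.
Qed.

(** What is retained of the exponents of a convenient power series without
    constant term: [gen_degree] excludes the exponent 0 and comes from
    integrality, [gen_axis] is convenience. *)
Record newton_generators : Prop := NewtonGenerators {
  gen_ge0 : forall t i, 0 <= b t 0 i;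
  gen_degree : forall t, 1 <= \sum_i b t 0 i;
  gen_axis : forall i : 'I_n, exists t, forall j, j != i -> b t 0 j = 0;
  gen_inj : injective b
}.

Definition polyhedron : set 'rV[R]_n :=
  [set x | exists w : T -> R, [/\ forall t, 0 <= w t, \sum_t w t = 1
     & forall i, lincomb b w 0 i <= x 0 i]].

(** The generators on the face cut out by [l], when [l] is at least 1 on all
    generators. *)
Definition tight l : {set T} := [set t | dot l (b t) == 1]%SET.

(** Supporting forms are normalized to be at least 1 on the generators. If the
    value 1 is not attained, [tight] is empty, so that the empty face is treated
    like the others. *)
Definition supporting l : Prop := forall t, 1 <= dot l (b t).

Hypothesis gens : newton_generators.

Lemma polyhedron_gen t : polyhedron (b t).
Proof.
exists (fun s => (s == t)%:R); split.
- by move=> s; exact: ler0n.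
- by rewrite (bigD1 t) //= eqxx big1 ?addr0 // => i /negPf ->.
- by move=> i; rewrite lincomb_pred1.
Qed.

Lemma polyhedron_up x (y : 'rV[R]_n) : polyhedron x -> (forall i, x 0 i <= y 0 i) ->
  polyhedron y.
Proof.
by move=> [w [w0 w1 wx]] xy; exists w; split => // i; apply: le_trans (xy i).
Qed.

(** If l i = 0, then l vanishes on the generator of the i-th axis. *)
Lemma supporting_gt0 l : (forall i, 0 <= l 0 i) -> supporting l ->
  forall i, 0 < l 0 i.
Proof.
move=> l0 lb i; rewrite lt0r l0 andbT; have [t bt] := gen_axis gens i.
apply/eqP => li; have := lb t; rewrite /dot big1 ?ler10 // => j _.
by have [->|/bt ->] := eqVneq j i; rewrite ?li ?mul0r ?mulr0.
Qed.

(** Complementary slackness. *)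
Lemma tight_attained l w x : (forall i, 0 < l 0 i) -> supporting l ->
  (forall t, 0 <= w t) -> (forall i, lincomb b w 0 i <= x 0 i) ->
  dot l x <= \sum_t w t ->
  (forall t, t \notin tight l -> w t = 0) /\ x = lincomb b w.
Proof.
move=> l0 lb w0 wx lx.
have le1 : \sum_t w t <= dot l (lincomb b w).
  by rewrite dot_lincomb; apply: ler_sum => t _; rewrite ler_peMr.
have le2 : dot l (lincomb b w) <= dot l x.
  by apply: dot_mono => // i; exact: ltW.
have eq1 : dot l (lincomb b w) = \sum_t w t.
  by apply: le_anti; rewrite le1 (le_trans le2).
have eq2 : dot l (lincomb b w) = dot l x.
  by apply: le_anti; rewrite le2 (le_trans lx).
split=> [t|].
  rewrite inE => bt; apply/eqP; move/eqP: eq1; rewrite dot_lincomb -subr_eq0.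
  rewrite -sumrB psumr_eq0; last first.
    by move=> s _; rewrite -[X in _ - X]mulr1 -mulrBr mulr_ge0 // subr_ge0.
  move=> /allP/(_ t); rewrite mem_index_enum => /(_ isT) /=.
  by rewrite -[X in _ - X]mulr1 -mulrBr mulf_eq0 subr_eq0 (negPf bt) orbF.
apply/rowP => i; apply/eqP; rewrite -subr_eq0; move/eqP: eq2.
rewrite eq_sym -subr_eq0 /dot -sumrB psumr_eq0; last first.
  by move=> j _; rewrite -mulrBr mulr_ge0 ?subr_ge0 // ltW.
move=> /allP/(_ i); rewrite mem_index_enum => /(_ isT) /=.
by rewrite -mulrBr mulf_eq0 (gt_eqF (l0 i)).
Qed.

Lemma supporting_polyhedron l x : (forall i, 0 <= l 0 i) -> supporting l ->
  polyhedron x -> 1 <= dot l x.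
Proof.
move=> l0 lb [w [w0 w1 wx]]; rewrite (le_trans _ (dot_mono l0 wx)) //.
by rewrite dot_lincomb -w1; apply: ler_sum => t _; rewrite ler_peMr.
Qed.

Lemma dot_hull l S a x : (forall t, t \in S -> dot l (b t) = a) -> hull b S x ->
  dot l x = a.
Proof.
move=> lS [w [w0 wS w1 ->]]; rewrite dot_lincomb.
rewrite -[RHS]mul1r -w1 mulr_suml; apply: eq_bigr => t _.
by have [/lS ->|/wS ->] := boolP (t \in S); rewrite ?mul0r.
Qed.

Lemma dot_tight l x : hull b (tight l) x -> dot l x = 1.
Proof. by apply: dot_hull => t; rewrite inE => /eqP. Qed.

Lemma hull_polyhedron S : hull b S `<=` polyhedron.
Proof. by move=> x [w [w0 wS w1 ->]]; exists w. Qed.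

Lemma is_compact_face_tight l : (forall i, 0 < l 0 i) -> supporting l ->
  tight l != finset.set0 -> is_compact_face polyhedron (hull b (tight l)).
Proof.
move=> l0 lb M0; split; last exact: compact_hull.
have lw0 i : 0 <= l 0 i by exact: ltW.
split; first exact/hull_nonempty.
exists l; apply/seteqP; split=> x /=.
  move=> hx; split; first exact: hull_polyhedron hx.
  move=> y Py; rewrite -!/(dot _ _) (dot_tight hx).
  exact: supporting_polyhedron.
move=> [[w [w0 w1 wx]] xmin].
have [t tM] := set0Pn _ M0.
have := xmin _ (polyhedron_gen t); rewrite -!/(dot _ _).
have -> : dot l (b t) = \sum_t w t by move: tM; rewrite inE w1 => /eqP.
by move=> /(tight_attained l0 lb w0 wx)[wM ->]; exists w.
Qed.

(** A form that is minimal on a compact face has positive coefficients: a zero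
    coefficient would make the face invariant under translation along an axis.
    Its minimum is then positive, and it is normalized to 1. *)
Lemma compact_face_tight F : is_compact_face polyhedron F ->
  exists l, [/\ forall i, 0 < l 0 i, supporting l & F = hull b (tight l)].
Proof.
move=> [[[x0 Fx0] [l FE]] Fcompact].
have [Px0 x0min] : polyhedron x0 /\ forall y, polyhedron y -> dot l x0 <= dot l y.
  by move: Fx0; rewrite FE.
have shift i a : 0 <= a -> polyhedron (x0 + a *: delta_mx 0 i).
  move=> a0; apply: polyhedron_up Px0 _ => j.
  by rewrite !mxE lerDl mulr_ge0.
have dot_shift i a : dot l (x0 + a *: delta_mx 0 i) = dot l x0 + a * l 0 i.
  have dotC u v : dot u v = dot v u.
    by rewrite /dot; apply: eq_bigr => j _; rewrite mulrC.
  by rewrite dotC dotDl dotZl dot_delta dotC.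
have l0 i : 0 < l 0 i.
  rewrite lt0r; apply/andP; split; last first.
    by have := x0min _ (shift i 1 ler01); rewrite dot_shift mul1r lerDl.
  apply/eqP => li.
  have inF a : 0 <= a -> F (x0 + a *: delta_mx 0 i).
    move=> a0; rewrite FE; split; first exact: shift.
    by move=> y /x0min; rewrite -!/(dot _ _) dot_shift li mulr0 addr0.
  have : compact ((fun x : 'rV[R]_n => x 0 i) @` F).
    apply: continuous_compact Fcompact.
    exact: continuous_subspaceT (@coord_continuous _ _ _ _ _).
  move=> /compact_bounded[M [_ /(_ (`|M| + 1))]].
  rewrite (le_lt_trans (ler_norm _)) ?ltrDl // => /(_ isT) Fle.
  pose a := `|x0 0 i| + `|M| + 2.
  have /inF Fa : 0 <= a by rewrite /a !addr_ge0.
  have := Fle _ (ex_intro2 _ _ _ Fa erefl).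
  rewrite /= !mxE !eqxx mulr1 => /(le_trans (ler_norm _)).
  have := ler_norm (- x0 0 i); rewrite normrN /a.
  move: (x0 0 i) `|x0 0 i| `|M| => u v w; clear=> ? ?; lra.
have lw0 i : 0 <= l 0 i by exact: ltW.
pose a := dot l x0.
have a0 : 0 < a.
  have [w [w0 w1 wx]] := Px0.
  have bt0 t : 0 < dot l (b t).
    rewrite lt0r (sumr_ge0 _ (fun i _ => mulr_ge0 (lw0 i) (gen_ge0 gens t i))) andbT.
    rewrite psumr_eq0 => [|i _]; last by rewrite mulr_ge0 ?(gen_ge0 gens).
    apply/negP => /allP bt; have := gen_degree gens t; rewrite big1 ?ler10 // => i _.
    have := bt i; rewrite mem_index_enum => /(_ isT) /=.
    by rewrite mulf_eq0 (gt_eqF (l0 i)) => /eqP.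
  apply: lt_le_trans (dot_mono lw0 wx); rewrite dot_lincomb lt0r.
  have wb_ge0 t : 0 <= w t * dot l (b t) by rewrite mulr_ge0 // ltW.
  rewrite sumr_ge0 // andbT psumr_eq0 //; apply/negP => /allP wt.
  move: w1; rewrite big1 => [/esym/eqP|t _]; first by rewrite oner_eq0.
  have := wt t; rewrite mem_index_enum => /(_ isT) /=.
  by rewrite mulf_eq0 (gt_eqF (bt0 t)) orbF => /eqP.
have lb : supporting (a^-1 *: l).
  move=> t; rewrite dotZl mulrC ler_pdivlMr // mul1r.
  exact/x0min/polyhedron_gen.
have l'0 i : 0 < (a^-1 *: l) 0 i by rewrite mxE mulr_gt0 ?invr_gt0.
exists (a^-1 *: l); split => //.
have [w [w0 w1 wx]] := Px0.
apply/seteqP; split=> x.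
  rewrite FE => -[[v [v0 v1 vx]] /(_ _ Px0) xx0].
  have := tight_attained l'0 lb v0 vx.
  rewrite v1 dotZl mulrC ler_pdivrMr // mul1r => /(_ xx0)[vM ->].
  by exists v.
move=> hx; rewrite FE; split; first exact: hull_polyhedron hx.
move=> y /x0min; apply: le_trans; rewrite -!/(dot _ _).
suff -> : dot l x = a by [].
have := dot_tight hx; rewrite dotZl => /(congr1 (fun r => a * r)).
by rewrite mulr1 mulVKf ?gt_eqF.
Qed.

End NewtonPolyhedron.

(** * The compact faces triangulate the orthant *)

Section FaceComplex.
Variables (R : realType) (n : nat) (T : finType) (b : T -> 'rV[R]_n).
Hypothesis gens : newton_generators b.
Local Open Scope classical_set_scope.
Implicit Types (S C : {set T}) (l m x : 'rV[R]_n).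

Local Notation tight := (tight b).
Local Notation supporting := (supporting b).

(** [S] is the vertex set of a compact face, or is empty. *)
Definition face_cell S : Prop := indep b S /\
  exists l, [/\ forall i, 0 < l 0 i, supporting l & hull b S = hull b (tight l)].

Definition face_cells : {set {set T}} := [set S | `[< face_cell S >]]%SET.

Lemma face_cellP S : reflect (face_cell S) (S \in face_cells).
Proof. by rewrite inE; exact: asboolP. Qed.

Lemma indep_generators_sub S C : indep b S ->
  (forall t, t \in S -> hull b C (b t)) ->
  (forall t, t \in C -> hull b S (b t)) -> S \subset C.
Proof.
move=> iS SC CS; apply/fintype.subsetP => t tS.
have [s sC /(gen_inj gens) <-//] := indep_generator_extreme iS tS (SC t tS) CS.
Qed.

Lemma indep_hull_inj S C : indep b S -> indep b C -> hull b S = hull b C -> S = C.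
Proof.
move=> iS iC hSC; apply/eqP; rewrite finset.eqEsubset; apply/andP.
by split; apply: indep_generators_sub => // t /(hull_generator b); rewrite hSC.
Qed.

(** A form that vanishes on the vertices in C and is 1 on the other vertices cuts
    out the face spanned by C. *)
Lemma hull_subface S C l x : C \subset S ->
  (forall t, t \in S -> dot l (b t) = (t \notin C)%:R) -> hull b S x ->
  0 <= dot l x /\ (dot l x = 0 -> hull b C x).
Proof.
move=> CS lS [w [w0 wS w1 ->]]; rewrite dot_lincomb.
have termE t : w t * dot l (b t) = w t * (t \notin C)%:R.
  by have [/lS ->//|/wS ->] := boolP (t \in S); rewrite !mul0r.
have term_ge0 t : 0 <= w t * dot l (b t) by rewrite termE mulr_ge0.
split=> [|/eqP]; first exact: sumr_ge0.
rewrite psumr_eq0 // => /allP wC; exists w; split=> // t tC.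
have := wC t; rewrite mem_index_enum termE tC mulr1 => /(_ isT) /=.
by move/eqP.
Qed.

(** Tilting a supporting form towards m, nonnegative on the face of l, cuts out
    the subface where m vanishes: the generators outside the face stay slack. *)
Lemma perturbed_form l m : (forall i, 0 < l 0 i) -> supporting l ->
  (forall t, t \in tight l -> 0 <= dot m (b t)) ->
  exists e, [/\ 0 < e, forall i, 0 < (l + e *: m) 0 i, supporting (l + e *: m) &
    forall t, t \in tight (l + e *: m) -> t \in tight l /\ dot m (b t) = 0].
Proof.
move=> l0 lb mtight.
pose a (j : 'I_n + T) := match j with
  inl i => l 0 i | inr t => dot l (b t) - 1 end.
pose d (j : 'I_n + T) := match j with
  inl i => m 0 i | inr t => dot m (b t) end.
have [e e0 eP] := small_perturbation a d.
have tightE t : t \in tight l -> dot (l + e *: m) (b t) = 1 + e * dot m (b t).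
  by rewrite inE dotDl dotZl => /eqP ->.
have slackE t : t \notin tight l -> 1 < dot (l + e *: m) (b t).
  rewrite inE => bt; have := eP (inr t); rewrite /= subr_gt0 lt_neqAle eq_sym bt lb.
  by move=> /(_ isT); rewrite dotDl dotZl addrAC subr_gt0.
exists e; split => // [i|t|t].
- by rewrite !mxE; exact: (eP (inl i) (l0 i)).
- have [tl|/slackE/ltW //] := boolP (t \in tight l).
  by rewrite tightE // lerDl mulr_ge0 ?mtight // ltW.
- have [tl|/slackE lt1] := boolP (t \in tight l); last first.
    by rewrite inE gt_eqF.
  rewrite inE tightE // -subr_eq0 addrAC subrr add0r mulf_eq0 (gt_eqF e0) /=.
  by move/eqP.
Qed.

Lemma face_cell_tight S l : hull b S = hull b (tight l) -> S \subset tight l.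
Proof.
move=> hS; apply/fintype.subsetP => t /(hull_generator b).
by rewrite hS inE => /dot_tight ->.
Qed.

(** Tilt the form that supports the larger face towards a form that vanishes
    exactly on the vertices of the smaller one. *)
Lemma face_cell_sub S C : S \subset C -> face_cell C -> face_cell S.
Proof.
move=> SC [iC [l [l0 lb hC]]]; split.
  move=> c cS; apply: iC => t tC; apply: cS; apply: contra tC.
  exact: fintype.subsetP.
have [m mC] := indep_dual (fun t => (t \notin S)%:R) iC.
have inC t : t \in tight l -> hull b C (b t).
  by move=> tl; rewrite hC; exact: hull_generator.
have [t tl|e [e0 le0 leb tightP]] := perturbed_form (m := m) l0 lb.
  by have [] := hull_subface SC mC (inC t tl).
exists (l + e *: m); split => //; apply/seteqP; split; apply: hull_sub => t.
  move=> tS; apply: hull_generator; have tC := fintype.subsetP SC _ tS.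
  have := fintype.subsetP (face_cell_tight hC) _ tC; rewrite !inE => /eqP ltE.
  by rewrite dotDl dotZl ltE mC // tS mulr0 addr0.
by move=> /tightP[tl mt]; have [_] := hull_subface SC mC (inC t tl); apply.
Qed.

(** Duality of linear programming: the minimum of l.x over the supporting forms
    is the supremum s of the total weights of the nonnegative combinations that
    are bounded by x. Farkas' lemma on pairs (l, h), which homogenizes the
    condition that l is at least 1 on the generators, provides a form with
    l.x <= s; the alternative is a combination of total weight greater than s. *)
Lemma optimal_form x : (forall i, 0 <= x 0 i) ->
  exists l, [/\ forall i, 0 < l 0 i, supporting l &
    forall m, (forall i, 0 < m 0 i) -> supporting m -> dot l x <= dot m x].
Proof.
move=> x0.
pose feasible c := (forall t, 0 <= c t) /\ (forall i, lincomb b c 0 i <= x 0 i).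
pose E : set R := [set r | exists2 c, feasible c & r = \sum_t c t].
have weight_le c : (forall t, 0 <= c t) -> \sum_t c t <= \sum_i lincomb b c 0 i.
  move=> c0; under [leRHS]eq_bigr do rewrite lincomb_coord.
  rewrite exchange_big; apply: ler_sum => t _; rewrite -mulr_sumr.
  by rewrite ler_peMr // (gen_degree gens).
have E0 : E 0.
  exists (fun=> 0); last by rewrite big1.
  by split=> // i; rewrite lincomb_coord big1 // => t _; rewrite mul0r.
have Eub : has_ubound E.
  exists (\sum_i x 0 i) => _ [c [c0 cx] ->].
  by apply: le_trans (weight_le c c0) _; exact: ler_sum.
pose s := sup E.
have le_s c : feasible c -> \sum_t c t <= s.
  by move=> cf; apply: ub_le_sup => //; exists c.
have s_le m : (forall i, 0 < m 0 i) -> supporting m -> s <= dot m x.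
  move=> m0 mb; apply: ge_sup; first by exists 0.
  move=> _ [c [c0 cx] ->]; have := dot_mono (fun i => ltW (m0 i)) cx.
  by apply: le_trans; rewrite dot_lincomb; apply: ler_sum => t _; rewrite ler_peMr.
suff [l [l0 lb lx]] : exists l, [/\ forall i, 0 <= l 0 i, supporting l
    & dot l x <= s].
  exists l; split=> //; first exact: (supporting_gt0 gens l0 lb).
  by move=> m m0 mb; apply: le_trans lx _; exact: s_le.
(* The inequalities l.b >= h, l >= 0 and l.x <= s h, for w = (l, h). *)
pose form (j : T + 'I_n + unit) (w : 'rV[R]_n * R^o) : R := match j with
  | inl (inl t) => dot w.1 (b t) - w.2
  | inl (inr i) => w.1 0 i
  | inr tt => s * w.2 - dot w.1 x end.
case: (pselect (forall w, (forall j, 0 <= form j w) -> 0 <= - w.2)); last first.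
  move=> /existsNP[[l h] /not_implyP[/= wP /negP]].
  rewrite oppr_ge0 -ltNge => h0; exists (h^-1 *: l); split.
  - by move=> i; rewrite mxE mulr_ge0 ?invr_ge0 ?(ltW h0) ?(wP (inl (inr i))).
  - move=> t; rewrite dotZl mulrC ler_pdivlMr // mul1r -subr_ge0.
    exact: (wP (inl (inl t))).
  - by rewrite dotZl mulrC ler_pdivrMr // -subr_ge0 (wP (inr tt)).
move=> gP; exfalso.
have form_lin j : linear_form (form j).
  case: j => [[t|i]|[]] a w v /=; rewrite ?dotDl ?dotZl ?mxE //;
    rewrite -[a *: w.2]/(a * w.2); ring.
have [|y y0 yE] := farkas form_lin _ gP.
  by move=> a w v /=; rewrite -[a *: w.2]/(a * w.2); ring.
pose c t := y (inl (inl t)); pose u := y (inr tt).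
have sum_form w : - w.2 = \sum_t c t * (dot w.1 (b t) - w.2) +
    \sum_i y (inl (inr i)) * w.1 0 i + u * (s * w.2 - dot w.1 x).
  by rewrite [LHS]yE big_sumType big_sumType /= [X in _ + X = _](big_pred1 tt).
have u0 : 0 <= u by exact: y0.
(* Evaluation of the certificate at (0, 1), and then at (e_i, 0). *)
have weight : \sum_t c t = 1 + u * s.
  have dot0 z : dot 0 z = 0 :> R by rewrite -(scale0r z) dotZl mul0r.
  have := sum_form (0, 1); rewrite /= dot0 subr0 mulr1.
  under eq_bigr do rewrite dot0 sub0r mulrN1.
  rewrite sumrN [X in _ + X + _]big1; first by lra.
  by move=> i _; rewrite mxE mulr0.
have le_ux i : lincomb b c 0 i <= u * x 0 i.
  have := sum_form (delta_mx 0 i, 0); rewrite /= mulr0 sub0r oppr0 dot_delta.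
  under eq_bigr do rewrite dot_delta addr0.
  rewrite -lincomb_coord (bigD1 i) //= mxE !eqxx mulr1 big1 ?addr0.
    by have := y0 (inl (inr i)); lra.
  by move=> j /negPf ji; rewrite mxE ji andbF mulr0.
have c0 t : 0 <= c t by exact: y0.
have [u00|un0] := eqVneq u 0.
  have := weight_le c c0; rewrite weight u00 mul0r addr0.
  have : \sum_i lincomb b c 0 i <= 0.
    by apply: sumr_le0 => i _; rewrite (le_trans (le_ux i)) // u00 mul0r.
  by move=> h1 h2; have := le_trans h2 h1; rewrite ler10.
have up : 0 < u by rewrite lt0r un0.
have : feasible (fun t => u^-1 * c t).
  split=> [t|i]; first by rewrite mulr_ge0 ?invr_ge0.
  by rewrite lincombZ mxE ler_pdivrMl.
move=> /le_s; rewrite -mulr_sumr weight ler_pdivrMl // => le1.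
by have := ltr_pwDl ltr01 (lexx (u * s)); rewrite ltNge le1.
Qed.

(** If x is not in the cone over the face of an optimal form l, Farkas' lemma
    gives a form m nonnegative on that face with m.x < 0, and tilting l towards m
    contradicts optimality. *)
Lemma tight_cover x : (forall i, 0 <= x 0 i) ->
  exists l c, [/\ forall i, 0 < l 0 i, supporting l, forall t, 0 <= c t,
    forall t, t \notin tight l -> c t = 0 & lincomb b c = x].
Proof.
move=> x0; have [l [l0 lb lmin]] := optimal_form x0.
pose form t (m : 'rV[R]_n) : R := if t \in tight l then dot m (b t) else 0.
case: (pselect (forall m, (forall t, 0 <= form t m) -> 0 <= dot m x)).
  move=> gP; have [||c c0 cE] := farkas _ _ gP.
  - move=> t a m p; rewrite /form; case: ifP => _; first exact: linear_form_dot.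
    by rewrite mulr0 addr0.
  - exact: linear_form_dot.
  exists l, (fun t => if t \in tight l then c t else 0); split=> //.
  - by move=> t; case: ifP.
  - by move=> t /negPf ->.
  apply/rowP => i; rewrite -(dot_delta i x) cE lincomb_coord.
  apply: eq_bigr => t _; rewrite /form dot_delta.
  by case: ifP; rewrite ?mul0r ?mulr0.
move=> /existsNP[m /not_implyP[mP /negP]]; rewrite -ltNge => mx.
have [t tl|e [e0 le0 leb _]] := perturbed_form (m := m) l0 lb.
  by have := mP t; rewrite /form tl.
have := lmin _ le0 leb; rewrite dotDl dotZl lerDl leNgt.
by rewrite pmulr_rlt0 ?mx.
Qed.

Hypothesis simp : forall l, (forall i, 0 < l 0 i) -> supporting l ->
  exists2 S, indep b S & hull b S = hull b (tight l).

Lemma face_cell_cover x : (forall i, 0 <= x 0 i) ->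
  exists c, [/\ forall t, 0 <= c t, nzsupp c \in face_cells & lincomb b c = x].
Proof.
move=> /tight_cover[l [c [l0 lb c0 cl <-]]].
have [S iS hS] := simp l0 lb.
have [t ct|c' [c'0 c'S _ lc]] := hull_transport (p := b) (q := b) (S := S) c0.
  rewrite hS; apply: hull_generator; apply: contraNT ct => /cl ->.
  by rewrite eqxx.
exists c'; split => //; apply/face_cellP; apply: (@face_cell_sub _ S).
  exact/nzsuppP.
by split=> //; exists l.
Qed.

(** The form supporting the cell of c1 takes the value sum of c1 at the common
    point, and is at least 1 on every generator. In case of equality all the
    generators used by c2 are tight for this form. *)
Lemma face_cell_carrier_tight (c1 c2 : T -> R) :
  (forall t, 0 <= c1 t) -> (forall t, 0 <= c2 t) ->
  face_cell (nzsupp c1) -> lincomb b c1 = lincomb b c2 ->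
  \sum_t c2 t <= \sum_t c1 t /\
  (\sum_t c1 t = \sum_t c2 t ->
   forall t, t \in nzsupp c2 -> hull b (nzsupp c1) (b t)).
Proof.
move=> c10 c20 [i1 [l [l0 lb h1]]] eq12.
have sum1 : dot l (lincomb b c1) = \sum_t c1 t.
  rewrite dot_lincomb; apply: eq_bigr => t _.
  have [->|ct] := eqVneq (c1 t) 0; first by rewrite mul0r.
  have : t \in tight l.
    by apply: (fintype.subsetP (face_cell_tight h1)); rewrite inE.
  by rewrite inE => /eqP ->; rewrite mulr1.
split.
  rewrite -sum1 eq12 dot_lincomb; apply: ler_sum => t _.
  by rewrite ler_peMr.
move=> eq_sum t t2; rewrite h1; apply: hull_generator.
have [||c2l _] := tight_attained (x := lincomb b c2) l0 lb c20.
- by [].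
- by rewrite -eq12 sum1 eq_sum.
by apply: contraTT t2 => /c2l ct; rewrite inE ct eqxx.
Qed.

Lemma face_cell_uniq c1 c2 :
  (forall t, 0 <= c1 t) -> (forall t, 0 <= c2 t) ->
  nzsupp c1 \in face_cells -> nzsupp c2 \in face_cells ->
  lincomb b c1 = lincomb b c2 -> c1 = c2.
Proof.
move=> c10 c20 /face_cellP f1 /face_cellP f2 eq12.
have [le21 sub21] := face_cell_carrier_tight c10 c20 f1 eq12.
have [le12 sub12] := face_cell_carrier_tight c20 c10 f2 (esym eq12).
have eq_sum : \sum_t c1 t = \sum_t c2 t by apply: le_anti; rewrite le12.
have h12 := sub21 eq_sum; have h21 := sub12 (esym eq_sum).
have s12 : nzsupp c1 \subset nzsupp c2 by apply: (indep_generators_sub f1.1).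
apply: (indep_inj f2.1) => //; apply/nzsuppP => //.
Qed.

Theorem face_cells_triangulation : orthant_triangulation b face_cells.
Proof.
split.
- exact: gen_ge0.
- by move=> S C SC /face_cellP CK; apply/face_cellP; exact: face_cell_sub CK.
- exact: face_cell_cover.
- exact: face_cell_uniq.
Qed.

End FaceComplex.

(** * Dimension, coordinates and order of faces *)

Section FaceInvariants.
Variables (R : realType) (n : nat) (T : finType) (b : T -> 'rV[R]_n).
Hypothesis gens : newton_generators b.
Local Open Scope classical_set_scope.
Implicit Types (S C : {set T}) (l : 'rV[R]_n).

Lemma hull_eq0 S : hull b S = set0 <-> S = finset.set0.
Proof.
split=> [h0|->].
  apply/eqP/negPn/negP => /(hull_nonempty b); rewrite h0.
  by case=> x.
by apply/eqP/negPn/negP => /set0P/(hull_nonempty b); rewrite eqxx.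
Qed.

Lemma k_hull S : k (hull b S) = #|coord_support b S|.
Proof.
rewrite /k; set A := #|[pred _ | _]|; have -> : A = #|~: coord_support b S|%SET.
  apply: eq_card => i; rewrite finset.in_setC unfold_in /=.
  apply/asboolP/coord_supportPn => [h t tS|h x [w [w0 wS w1 ->]]].
    by apply: h; exact: hull_generator.
  rewrite lincomb_coord big1 // => t _.
  by have [/h ->|/wS ->] := boolP (t \in S); rewrite ?mulr0 ?mul0r.
have := cardsC (coord_support b S); rewrite card_ord => cardE.
by rewrite -[X in (X - _)%N]cardE addnK.
Qed.

(** Affinely independent points of the hull have linearly independent weight
    vectors, because the weights have sum 1; so there are at most |S| of them. *)
Lemma affine_dim_hull S : indep b S -> S != finset.set0 -> (#|S| <= n)%N ->
  (affine_dim (hull b S)).+1 = #|S|.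
Proof.
move=> iS; rewrite -card_gt0 => S0 Sn.
suff -> : affine_dim (hull b S) = #|S|.-1 by rewrite prednK.
apply/eqP; rewrite eqn_leq; apply/andP; split.
  apply/bigmax_leqP => m /asboolP[p [ip hp]].
  have /choice[w wP] := hp.
  (* The rows are the barycentric coordinates of the points. *)
  pose M : 'M[R]_(m.+1, #|S|) := \matrix_(i, a) w i (enum_val a).
  suff : row_free M.
    rewrite /row_free => /eqP rM; rewrite -ltnS prednK // -rM.
    exact: rank_leq_col.
  apply: inj_row_free => u uM.
  have off t : \sum_i u 0 i * w i t = 0.
    have [tS|tS] := boolP (t \in S); last first.
      by rewrite big1 // => i _; have [_ -> // _ _] := wP i; rewrite mulr0.
    move/rowP/(_ (enum_rank_in tS t)): uM; rewrite !mxE => uM.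
    by rewrite -[RHS]uM; apply: eq_bigr => i _; rewrite mxE enum_rankK_in.
  apply/rowP => i; rewrite mxE; apply: (ip (fun i => u 0 i)).
    transitivity (\sum_i \sum_t u 0 i * w i t).
      by apply: eq_bigr => j _; rewrite -mulr_sumr; have [_ _ -> _] := wP j; rewrite mulr1.
    by rewrite exchange_big big1.
  transitivity (lincomb b (fun t => \sum_i u 0 i * w i t)).
    by rewrite lincomb_sum; apply: eq_bigr => j _; have [_ _ _ <-] := wP j.
  by rewrite /lincomb big1 // => t _; rewrite off scale0r.
have lt : (#|S|.-1 < n.+1)%N by rewrite ltnS (leq_trans (leq_pred _)).
apply: (@leq_bigmax_cond _ _ (fun m : 'I_n.+1 => m : nat) (Ordinal lt)).
apply/asboolP => /=.
exists (fun a => b (enum_val (cast_ord (prednK S0) a))); split.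
  move=> w _ wp a.
  pose u : 'rV[R]_#|S| := \row_a w (cast_ord (esym (prednK S0)) a).
  have uE a' : u 0 (cast_ord (prednK S0) a') = w a' by rewrite mxE cast_ordK.
  rewrite -uE -extend_coeffs_enum_val; apply: iS.
    by move=> t; exact: extend_coeffs_out.
  rewrite lincomb_extend_coeffs -[RHS]wp (reindex (cast_ord (prednK S0))) /=.
    by apply: eq_bigr => a' _; rewrite uE.
  by exists (cast_ord (esym (prednK S0))) => ? _; rewrite ?cast_ordK ?cast_ordKV.
by move=> a; apply: hull_generator; exact: enum_valP.
Qed.

Lemma d_hull S : indep b S -> (#|S| <= n)%N -> d (hull b S) = #|S|.
Proof.
move=> iS Sn; rewrite /d; case: eqP => [/hull_eq0 ->|h0]; first by rewrite cards0.
by apply: affine_dim_hull => //; apply/eqP => S0; apply: h0; apply/hull_eq0.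
Qed.

(** If the hull of S is a face of the hull of C, every vertex of S is a convex
    combination of vertices of C, which by minimality of the form lie on the face
    as well. The members of S being extreme on it, they are among these vertices
    of C. *)
Lemma face_le_hull S C : indep b S -> indep b C ->
  face_le (hull b S) (hull b C) <-> S \subset C.
Proof.
move=> iS iC; split.
  case=> [/hull_eq0 ->|[_ [l hE]]]; first exact: finset.sub0set.
  have hC x : hull b S x -> hull b C x by rewrite hE => -[].
  have min x y : hull b S x -> hull b C y -> dot l x <= dot l y.
    by rewrite hE => -[_ xmin] /xmin.
  have inter t : t \in S -> hull b (C :&: [set t | `[< hull b S (b t) >]])%SET (b t).
    move=> tS; have ht := hull_generator b tS.
    have [w [w0 wC w1 tE]] := hC _ ht; exists w; split => // s.
    rewrite inE negb_and => /orP[/wC //|]; rewrite inE => sS.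
    apply/eqP; apply: contraNT sS => ws; apply/asboolP.
    have inC r : w r != 0 -> hull b C (b r).
      by move=> wr; apply: hull_generator; apply: contraNT wr => /wC ->.
    rewrite hE; split; first exact: inC.
    move=> y hy; apply: le_trans (min _ _ ht hy); rewrite -!/(dot _ _).
    have term_ge0 r : 0 <= w r * (dot l (b r) - dot l (b t)).
      have [->|/inC hr] := eqVneq (w r) 0; first by rewrite mul0r.
      by rewrite mulr_ge0 // subr_ge0; exact: min.
    have : \sum_r w r * (dot l (b r) - dot l (b t)) = 0.
      under eq_bigr do rewrite mulrBr.
      by rewrite sumrB -mulr_suml w1 mul1r -dot_lincomb -tE subrr.
    move/eqP; rewrite psumr_eq0 // => /allP/(_ s); rewrite mem_index_enum.
    move=> /(_ isT) /=; rewrite mulf_eq0 (negPf ws) subr_eq0 /= => /eqP ->.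
    by rewrite lexx.
  suff : S \subset (C :&: [set t | `[< hull b S (b t) >]])%SET.
    by rewrite finset.subsetI => /andP[].
  apply: (indep_generators_sub gens iS inter) => t.
  by rewrite !inE => /andP[_ /asboolP].
move=> SC; have [->|S0] := eqVneq S finset.set0; first by left; apply/hull_eq0.
right; split; first exact/hull_nonempty.
have [l lC] := indep_dual (fun t => (t \notin S)%:R) iC.
exists l; apply/seteqP; split=> x /=.
  move=> hx; split; first exact: hull_subset hx.
  move=> y /(hull_subface SC lC)[ly _]; rewrite -!/(dot _ _).
  rewrite (dot_hull (a := 0) _ hx) // => t tS.
  by rewrite lC ?tS //; exact: (fintype.subsetP SC).
move=> [hx xmin]; have [lx] := hull_subface SC lC hx; apply.
have [t tS] := set0Pn _ S0; have tC := fintype.subsetP SC _ tS.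
apply: le_anti; rewrite lx andbT.
by have := xmin _ (hull_generator b tC); rewrite -!/(dot _ _) lC // tS.
Qed.

(** The vertices of a compact face that is a simplex are generators, as extreme
    points of the hull of the tight generators. A form that is 1 on the face
    turns affine independence into linear independence. *)
Lemma simplicial_tight :
  (forall F, is_compact_face (polyhedron b) F -> is_simplex F) ->
  forall l, (forall i, 0 < l 0 i) -> supporting b l ->
  exists2 S, indep b S & hull b S = hull b (tight b l).
Proof.
move=> simp l l0 lb; have [M0|M0] := eqVneq (tight b l) finset.set0.
  exists finset.set0; last by rewrite M0.
  by move=> c c0 _ t; apply: c0; rewrite finset.in_set0.
have [m [p [ip hE]]] := simp _ (is_compact_face_tight l0 lb M0).
rewrite convex_hull_range in hE.
have hp i : hull b (tight b l) (p i).
  by rewrite hE; apply: hull_generator; rewrite finset.in_setT.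
have iP : indep p [set: 'I_m]%SET.
  move=> c _ c0; apply: ip => //.
  have := dot_lincomb p c l; rewrite c0; under eq_bigr do rewrite (dot_tight (hp _)) mulr1.
  by move=> <-; rewrite /dot big1 // => i _; rewrite mxE mulr0.
have /choice[g gP] i : exists t, t \in tight b l /\ b t = p i.
  have [t tM|t tM tE] := indep_generator_extreme iP (finset.in_setT i) (hp i).
    by rewrite -hE; exact: hull_generator.
  by exists t.
have bg i : b (g i) = p i by case: (gP i).
exists [set g i | i : 'I_m]%SET.
  move=> c cS c0.
  have g_inj : injective g.
    move=> i j gij; apply/eqP/negPn/negP => ij.
    have /(congr1 (fun h => h i)) : (fun k => (k == i)%:R) = (fun k => (k == j)%:R) :> ('I_m -> R).
      apply: (indep_inj iP) => [k|k|]; rewrite ?finset.in_setT //.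
      by rewrite !lincomb_pred1 -!bg gij.
    by rewrite eqxx (negPf ij) => /eqP; rewrite oner_eq0.
  have cg i : c (g i) = 0.
    apply: (iP (fun i => c (g i))) => [j|]; first by rewrite finset.in_setT.
    rewrite -[RHS]c0 /lincomb [RHS](bigID (mem [set g i | i : 'I_m]%SET)) /=.
    rewrite [X in _ = _ + X]big1 => [|t /cS ->]; last by rewrite scale0r.
    rewrite addr0 big_imset /=; last by move=> ? ? _ _; exact: g_inj.
    by apply: eq_bigr => j _; rewrite bg.
  move=> t; have [/imsetP[i _ ->]|/cS //] := boolP (t \in [set g i | i : 'I_m]%SET).
  exact: cg.
rewrite hE; apply/seteqP; split; apply: hull_sub.
  by move=> _ /imsetP[i _ ->]; rewrite bg; apply: hull_generator; rewrite finset.in_setT.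
by move=> i _; rewrite -bg; apply: hull_generator; apply: imset_f.
Qed.

Lemma le_Gamma_cells :
  (forall F, is_compact_face (polyhedron b) F -> is_simplex F) ->
  forall s, (s = set0 \/ is_compact_face (polyhedron b) s) <->
    exists2 S, S \in face_cells b & s = hull b S.
Proof.
move=> simp s; split.
  case=> [->|].
    exists finset.set0; last by apply/esym/hull_eq0.
    have [//|c [_ cK lc]] := face_cell_cover gens (simplicial_tight simp) (x := 0).
      by move=> i; rewrite mxE.
    move: cK => /face_cellP cK; apply/face_cellP.
    by apply: face_cell_sub cK; exact: finset.sub0set.
  move=> /(compact_face_tight gens)[l [l0 lb ->]].
  have [S iS hS] := simplicial_tight simp l0 lb.
  exists S => //; apply/face_cellP; split=> //; by exists l.
move=> [S /face_cellP[iS [l [l0 lb hS]]] ->].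
have [->|S0] := eqVneq S finset.set0; first by left; apply/hull_eq0.
right; rewrite hS; apply: is_compact_face_tight => //.
by apply/(hull_nonempty b); rewrite -hS; apply/hull_nonempty.
Qed.

End FaceInvariants.

(** * The Newton polytope of a convenient power series *)

Section NewtonPolytope.
Variables (R : realType) (n : nat) (f : power_series R n).
Local Open Scope classical_set_scope.

(** A point of an axis that is a convex combination of points of the orthant
    uses only points of the axis, and an exponent that they dominate is on this
    axis as well. *)
Lemma convenient_axis_exponent : convenient f -> forall i : 'I_n,
  exists2 nu, f nu != 0 & forall j, j != i -> nu j = 0%N.
Proof.
move=> conv i; have [_ [m [p [w [pP w0 w1 ->]]]] axis] := conv i.
have [a wa] : exists a, w a != 0.
  apply/existsP; rewrite -negb_forall; apply/negP => /forallP w00.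
  move: w1; rewrite big1 => [/esym/eqP|j _]; first by rewrite oner_eq0.
  by apply/eqP; exact: w00.
have p_ge0 c j : 0 <= p c 0 j.
  have [nu _ pnu] := pP c; apply: le_trans (pnu j).
  by rewrite mxE ler0n.
have [nu fnu pnu] := pP a; exists nu => // j /axis.
rewrite summxE => /eqP; rewrite psumr_eq0 => [/allP/(_ a)|c _]; last first.
  by rewrite mxE mulr_ge0.
rewrite mem_index_enum mxE => /(_ isT) /=; rewrite mulf_eq0 (negPf wa) /= => /eqP paj.
have := pnu j; rewrite paj mxE lern0 => /eqP ->//.
Qed.

Variable N : nat.

(** The exponents of the series of degree less than N. For N large enough they
    determine the Newton polytope, which makes it finitely generated. *)
Definition low_exponent : predArgType := {nu : bmultinom n N | f (bmnm nu) != 0}.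

Definition low_vector (nu : low_exponent) : 'rV[R]_n :=
  exponent_vector R (bmnm (val nu)).

Hypothesis low_dominates : forall nu, f nu != 0 ->
  exists mu : low_exponent, forall i, (bmnm (val mu) i <= nu i)%N.

(** A convex combination of translated orthants is a translate of the combination
    of their corners; conversely the excess of x over a combination of generators
    may be added to each of them. *)
Lemma newton_polytopeE : newton_polytope f = polyhedron low_vector.
Proof.
apply/seteqP; split=> x.
  move=> [m [p [w [pP w0 w1 ->]]]].
  have /choice[g gP] a : exists mu : low_exponent, forall i, low_vector mu 0 i <= p a 0 i.
    have [nu fnu pnu] := pP a; have [mu le_mu] := low_dominates fnu.
    by exists mu => i; apply: le_trans (pnu i); rewrite !mxE ler_nat.
  exists (fun t => \sum_a w a * (t == g a)%:R); split.
  - by move=> t; apply: sumr_ge0 => a _; rewrite mulr_ge0.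
  - rewrite exchange_big -[RHS]w1; apply: eq_bigr => a _.
    by rewrite -mulr_sumr (bigD1 (g a)) //= eqxx big1 ?addr0 ?mulr1 // => t /negPf ->.
  - move=> i; rewrite lincomb_sum !summxE; apply: ler_sum => a _.
    by rewrite lincomb_pred1 !mxE ler_wpM2l //; have := gP a i; rewrite mxE.
move=> [w [w0 w1 wx]].
pose g (a : 'I_#|{: low_exponent}|) := enum_val a.
have sum_enum (V : nmodType) (F : low_exponent -> V) : \sum_t F t = \sum_a F (g a).
  by rewrite (reindex g) //; apply: onW_bij; exact: enum_val_bij.
exists #|{: low_exponent}|, (fun a => low_vector (g a) + (x - lincomb low_vector w)).
exists (fun a => w (g a)); split.
- move=> a; exists (bmnm (val (g a))); first exact: (valP (g a)).
  by move=> i; rewrite [leRHS]mxE lerDl 2!mxE subr_ge0.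
- by move=> a.
- by rewrite -sum_enum.
- under eq_bigr do rewrite scalerDr.
  rewrite big_split /= -scaler_suml -(sum_enum _ (fun t => w t)) w1 scale1r.
  by rewrite -(sum_enum _ (fun t => w t *: low_vector t)) addrC subrK.
Qed.

Lemma low_generators : f (@mnm0 n) = 0 ->
  (forall i : 'I_n, exists t : low_exponent, forall j, j != i -> bmnm (val t) j = 0%N) ->
  newton_generators low_vector.
Proof.
move=> f0 axis; split.
- by move=> t i; rewrite mxE ler0n.
- move=> t; under eq_bigr do rewrite mxE.
  rewrite -natr_sum -mdegE ler1n lt0n mdeg_eq0; apply/eqP => t0.
  by have := valP t; rewrite /= t0 f0 eqxx.
- move=> i; have [t tP] := axis i; exists t => j ji.
  by rewrite mxE tP.
- move=> t u tu; apply/val_inj/val_inj/mnmP => i /=.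
  by move/rowP/(_ i): tu; rewrite !mxE => /eqP; rewrite eqr_nat => /eqP.
Qed.

End NewtonPolytope.

(** Choose an exponent a(i) on each axis and N larger than the sum of their
    degrees. An exponent of degree at least N exceeds a(i) in its i-th coordinate
    for some i, and so dominates a(i). *)
Lemma low_exponents_exist (R : realType) (n : nat) (f : power_series R n) :
  convenient f -> exists N,
    (forall nu, f nu != 0 ->
       exists mu : low_exponent f N, forall i, (bmnm (val mu) i <= nu i)%N) /\
    (forall i : 'I_n, exists t : low_exponent f N,
       forall j, j != i -> bmnm (val t) j = 0%N).
Proof.
move=> /convenient_axis_exponent conv.
have /choice[a aP] i : exists nu, f nu != 0 /\ forall j, j != i -> nu j = 0%N.
  by have [nu ? ?] := conv i; exists nu.
pose N := (\sum_i mdeg (a i)).+1; exists N.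
have a_low i : (mdeg (a i) < N)%N by rewrite ltnS (bigD1 i) //= leq_addr.
pose low nu (nuN : (mdeg nu < N)%N) (fnu : f nu != 0) : low_exponent f N :=
  exist _ (BMultinom nuN) fnu.
split=> [nu fnu|i]; last by exists (low _ (a_low i) (aP i).1); exact: (aP i).2.
have [nuN|leN] := ltnP (mdeg nu) N; first by exists (low _ nuN fnu).
have [i ai] : exists i, (a i i <= nu i)%N.
  apply/existsP; apply: contraLR leN; rewrite negb_exists => /forallP lt_a.
  rewrite -ltnNge ltnS mdegE; apply: leq_sum => i _.
  rewrite (leq_trans (n := a i i)) //; first by rewrite ltnW // ltnNge lt_a.
  by rewrite mdegE (bigD1 i) //= leq_addr.
exists (low _ (a_low i) (aP i).1) => j /=.
by have [->//|/(aP i).2 ->] := eqVneq j i.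
Qed.

Theorem theoremA (R : realType) (n : nat) (f : power_series R n)
  (f_convergent : convergent f)
  (f_at_0 : f (@mnm0 n) = 0)
  (f_non_degenerate : non_degenerate f)
  (f_simplicial : simplicial f)
  (f_convenient : convenient f)
  (s : set 'rV[R]_n) (hs : le_Gamma f s) :
  forall (K : fieldType) (t : K), t != 0 ->
    (map_poly intr (combinatorial_polynomial f s)).[t] =
    (map_poly intr (combinatorial_polynomial f s)).[t^-1] * t ^+ (n - d s).
Proof.
move=> F t t0; have [N [dom axis]] := low_exponents_exist f_convenient.
pose b := @low_vector R n f N.
have gens : newton_generators b := low_generators f_at_0 axis.
have PE : newton_polytope f = polyhedron b := newton_polytopeE dom.
have simp : forall G, is_compact_face (polyhedron b) G -> is_simplex G.
  by rewrite -PE; exact: f_simplicial.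
have tri := face_cells_triangulation gens (simplicial_tight simp).
have GammaE r : le_Gamma f r <-> exists2 S, S \in face_cells b & r = hull b S.
  by rewrite /le_Gamma PE; exact: le_Gamma_cells.
have indepK S : S \in face_cells b -> indep b S by move=> /face_cellP[].
have cardK S : S \in face_cells b -> (#|S| <= n)%N.
  by move=> SK; rewrite (leq_trans (card_cell_le_ncoord tri SK)) // ncoord_le_n.
have [S0 S0K sE] := (GammaE s).1 hs.
have polyE : combinatorial_polynomial f s =
    \sum_(S in face_cells b | S0 \subset S)
      (-1) ^+ (n - #|coord_support b S|) *
      ('X - 1) ^+ (#|coord_support b S| - #|S|).
  pose A := [pred S | (S \in face_cells b) && (S0 \subset S)].
  rewrite /combinatorial_polynomial.
  rewrite (_ : mkset _ = (fun S => hull b S) @` [set` enum A])%classic; last first.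
    apply/seteqP; split=> [r [/GammaE[S SK ->]]|_ [S + <-]].
      rewrite sE => /(face_le_hull gens (indepK _ S0K) (indepK _ SK)) S0S.
      by exists S; rewrite //= mem_enum inE SK.
    rewrite /= mem_enum => /andP[SK S0S]; split; first by apply/GammaE; exists S.
    by rewrite sE; apply/(face_le_hull gens) => //; exact: indepK.
  rewrite fsbig_image; last first.
    move=> S C; rewrite !inE /= !mem_enum => /andP[SK _] /andP[CK _] hSC.
    exact: (indep_hull_inj gens (indepK _ SK) (indepK _ CK)).
  rewrite -fsbig_seq ?enum_uniq // big_enum /=; apply: eq_bigr => S /andP[SK _].
  by rewrite k_hull (d_hull (indepK _ SK) (cardK _ SK)).
have evalE (z : F) : (map_poly intr (combinatorial_polynomial f s)).[z] =
    \sum_(S in face_cells b | S0 \subset S)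
      (-1) ^+ (n - #|coord_support b S|) *
      (z - 1) ^+ (#|coord_support b S| - #|S|).
  rewrite polyE rmorph_sum horner_sum; apply: eq_bigr => S _.
  by rewrite rmorphM !rmorphXn rmorphN rmorphB rmorph1 /= map_polyX !hornerE.
rewrite !evalE sE (d_hull (indepK _ S0K) (cardK _ S0K)).
exact: (triangulation_symmetry tri).
Qed.
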